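(* Let $K$ be a field. The maps \[ S(-)\colon\{K\text{-rational quivers}\}\to\{\text{étale }K\text{-species}\},\qquad \Gamma_K(-)\colon\{\text{étale }K\text{-species}\}\to\{K\text{-rational quivers}\} \] (defined in the context) extend to quasi-inverse contravariant functors of the underlying categories, inducing anti-equivalences of the underlying full subcategories of split objects, i.e. of split $K$-rational quivers and of split étale $K$-species.
   Context: Let $K^{\rm sep}$ be a separable algebraic closure of $K$. Galois groups carry the profinite topology. Below, $L/K$ is a Galois extension with group $G=\operatorname{Gal}(L/K)$, large enough that all Galois actions considered are defined as $G$-actions and all finite étale algebras considered split over $L$; one may take $L=K^{\rm sep}$. Quivers. A quiver is $\Gamma=(V,E,s,t)$ with finite sets $V$ (vertices) and $E$ (edges) and maps $s,t\colon E\to V$ (source, target). A $K$-rational quiver $\Gamma_K$ is a quiver $\Gamma$ together with a group homomorphism $\rho\colon\operatorname{Gal}(L/K)\to\operatorname{Aut}(\Gamma)$, for a Galois extension $L/K$, such that the induced actions on the discrete sets $V$ and $E$ are continuous; in particular $s(\sigma e)=\sigma s(e)$ and $t(\sigma e)=\sigma t(e)$ for all $\sigma\in\operatorname{Gal}(L/K)$, $e\in E$. A morphism of $K$-rational quivers is a homomorphism of quivers commuting with the $\operatorname{Gal}(K^{\rm sep}/K)$-actions. $\Gamma_K$ is split if $\rho$ is trivial. Species. A $K$-species $S=(L_i,{}_iM_j)_{i,j\in I}$ is a finite collection $(L_i)_{i\in I}$ of division rings containing $K$ in their center, together with, for each pair $i,j\in I$, an $L_i,L_j$-bimodule ${}_iM_j$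 on which the left and right $K$-vector space structures agree and which is finite-dimensional over $K$. It is an étale $K$-species if each $L_i$ is a finite separable (field) extension of $K$ and each ${}_iM_j$ is a commutative $L_i,L_j$-bialgebra (a commutative $K$-algebra with structure homomorphisms from $L_i$ and from $L_j$) which is finite étale as a $K$-algebra. A morphism $f\colon S=(L_i,{}_iM_j)_{i,j\in I}\to T=(\widetilde L_i,{}_i\widetilde M_j)_{i,j\in\widetilde I}$ of étale $K$-species consists of (i) a map $\iota\colon I\to\widetilde I$; (ii) for each $i\in I$ a $K$-algebra homomorphism $\iota_i\colon L_i\to\widetilde L_{\iota(i)}$; (iii) for all $i,j\in I$ an $L_i,L_j$-bialgebra homomorphism $\iota_{ij}\colon{}_iM_j\to{}_{\iota(i)}\widetilde M_{\iota(j)}$. An étale $K$-species is split if for all $i,j\in I$ one has $L_i\cong K$ and ${}_iM_j$ is a product of copies of $K$ as a $K$-bialgebra. The species $S(\Gamma_K)$. Let $I=G\backslash V$, and for $i,j\in I$ let $E_{ij}=\{e\in E\mid s(e)\in i,\ t(e)\in j\}$. For a vertex or edge $x$ with stabilizer $G_x$ put $L(x)=L^{G_x}$. Fix a representative $v_i\in i$ for each $i\in I$ and a representative $e_\varepsilon\in\varepsilon$ for each orbit $\varepsilon\in G\backslash E_{ij}$. Then $S(\Gamma_K)=(L_i,{}_iM_j)_{i,j\in I}$ with $L_i=L(v_i)$ and ${}_iM_j=\bigoplus_{\varepsilon\in G\backslash E_{ij}}L(e_\varepsilon)$. The field $L(e_\varepsilon)$ contains $L(s(e_\varepsilon))$ and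 $L(t(e_\varepsilon))$; choosing $\sigma_\varepsilon,\tau_\varepsilon\in G$ with $s(e_\varepsilon)=\sigma_\varepsilon v_i$ and $t(e_\varepsilon)=\tau_\varepsilon v_j$, it is an $L_i,L_j$-bialgebra via $\sigma_\varepsilon\colon L(v_i)\to L(s(e_\varepsilon))\subseteq L(e_\varepsilon)$ and $\tau_\varepsilon\colon L(v_j)\to L(t(e_\varepsilon))\subseteq L(e_\varepsilon)$. The quiver $\Gamma_K(S)$. For an étale $K$-species $S=(L_i,{}_iM_j)_{i,j\in I}$ let $V=\bigsqcup_{i\in I}\operatorname{Hom}_K(L_i,L)$ and $E=\bigsqcup_{i,j\in I}\bigsqcup_{\varepsilon}\operatorname{Hom}_K(L_\varepsilon,L)$, where $\varepsilon$ runs over the maximal ideals of ${}_iM_j$ and $L_\varepsilon={}_iM_j/\varepsilon$ (Homs of $K$-algebras). $G$ acts on the left by post-composition. For $\tau\in\operatorname{Hom}_K(L_\varepsilon,L)$ with $\varepsilon$ a maximal ideal of ${}_iM_j$, $s(\tau)$ is the composite $L_i\to L_\varepsilon\xrightarrow{\tau}L$ and $t(\tau)$ is the composite $L_j\to L_\varepsilon\xrightarrow{\tau}L$. Then $\Gamma_K(S)=(V,E,s,t)$ with this $G$-action.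
   Formalization: In a morphism S → T of étale species the index map is taken from Ĩ to I, with maps L_ι(i) → L̃_i and M_ι(i)ι(j) → M̃_ij; with ι: I → Ĩ as printed, the one-index split species with M = 0 is terminal among split species and the claimed anti-equivalence fails. *)

(* Defs.v *)
From HB Require Import structures.
From mathcomp Require Import all_boot all_order all_algebra all_field.
From mathcomp Require Import generic_quotient ring_quotient.
From mathcomp Require Import boolp classical_sets functions cardinality topology.

Set Implicit Arguments.
Unset Strict Implicit.
Unset Printing Implicit Defensive.

Import GRing.Theory.

Local Open Scope classical_set_scope.
Local Open Scope ring_scope.
Local Open Scope quotient_scope.

(** * Categories and contravariant functors *)

Record category := Category {
  obj :> Type;
  hom : obj -> obj -> Type;
  idc : forall X, hom X X;
  compc : forall X Y Z, hom Y Z -> hom X Y -> hom X Z;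
  compcA : forall X Y Z W (h : hom Z W) (g : hom Y Z) (f : hom X Y),
    compc h (compc g f) = compc (compc h g) f;
  comp1c : forall X Y (f : hom X Y), compc (idc Y) f = f;
  compc1 : forall X Y (f : hom X Y), compc f (idc X) = f }.

Arguments hom {c} _ _.
Arguments idc {c} _.
Arguments compc {c X Y Z} _ _.

Record contrafunctor (C D : category) := Contrafunctor {
  fobj :> C -> D;
  fhom : forall (X Y : C), hom X Y -> hom (fobj Y) (fobj X);
  fhom1 : forall X : C, fhom (idc X) = idc (fobj X);
  fhomM : forall (X Y Z : C) (g : hom Y Z) (f : hom X Y),
    fhom (compc g f) = compc (fhom f) (fhom g) }.

Arguments fhom {C D} _ {X Y} _.

Definition is_iso (C : category) (X Y : C) (f : hom X Y) :=
  exists g : hom Y X, compc g f = idc X /\ compc f g = idc Y.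

(* The identity of C is naturally isomorphic to the covariant composite of
   the contravariant functors F and G. *)
Definition nat_iso_id (C D : category)
    (F : contrafunctor C D) (G : contrafunctor D C) :=
  exists a : forall X : C, hom X (G (F X)),
    (forall X, is_iso (a X)) /\
    (forall (X Y : C) (f : hom X Y),
       compc (a Y) f = compc (fhom G (fhom F f)) (a X)).

Definition quasi_inverse (C D : category)
    (F : contrafunctor C D) (G : contrafunctor D C) :=
  nat_iso_id F G /\ nat_iso_id G F.

Definition full_subcategory (C : category) (P : C -> Prop) : category :=
  @Category {X : C | P X} (fun X Y => hom (sval X) (sval Y))
    (fun X => idc (sval X)) (fun _ _ _ g f => compc g f)
    (fun _ _ _ _ h g f => compcA h g f)
    (fun _ _ f => comp1c f) (fun _ _ f => compc1 f).

Definition restrict_functor (C D : category) (P : C -> Prop) (Q : D -> Prop)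
    (F : contrafunctor C D) (FPQ : forall X, P X -> Q (F X)) :
    contrafunctor (full_subcategory P) (full_subcategory Q) :=
  @Contrafunctor (full_subcategory P) (full_subcategory Q)
    (fun X => exist Q (F (sval X)) (FPQ _ (svalP X)))
    (fun _ _ f => fhom F f)
    (fun X => fhom1 F (sval X)) (fun _ _ _ g f => fhomM F g f).

(** * Commutative algebras over a field

  A K-algebra is a commutative ring A, possibly zero, with a ring morphism
  K -> A. *)

Record alghom (K A B : comPzRingType)
    (a : {rmorphism K -> A}) (b : {rmorphism K -> B}) := AlgHom {
  algf :> {rmorphism A -> B};
  alghomK : forall x, algf (a x) = b x }.

Lemma rmorphism_eq (A B : comPzRingType) (f g : {rmorphism A -> B}) :
  f =1 g -> f = g.
Proof.
case: f => f [[f1] [f2]]; case: g => g [[g1] [g2]] /= /funext fg.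
by move: f1 f2; rewrite fg => f1 f2; congr GRing.RMorphism.Pack;
   congr GRing.RMorphism.Class; [congr Algebra.isNmodMorphism.Axioms_ |
   congr GRing.isMonoidMorphism.Axioms_]; exact: Prop_irrelevance.
Qed.

Lemma alghom_eq (K A B : comPzRingType) (a : {rmorphism K -> A})
  (b : {rmorphism K -> B}) (f g : alghom a b) : f =1 g -> f = g.
Proof.
case: f g => [f fK] [g gK] /= /rmorphism_eq fg.
by rewrite fg in fK *; congr AlgHom; exact: Prop_irrelevance.
Qed.

Definition idrm (A : comPzRingType) : {rmorphism A -> A} := idfun.
Definition comprm (A B C : comPzRingType) (g : {rmorphism B -> C})
  (f : {rmorphism A -> B}) : {rmorphism A -> C} := g \o f.

Definition alg_id (K A : comPzRingType) (a : {rmorphism K -> A}) : alghom a a :=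
  @AlgHom _ _ _ a a (idrm A) (fun=> erefl).

Lemma alg_comp_subproof (K A B C : comPzRingType) (a : {rmorphism K -> A})
    (b : {rmorphism K -> B}) (c : {rmorphism K -> C})
    (g : alghom b c) (f : alghom a b) x : comprm g f (a x) = c x.
Proof. by rewrite /= !alghomK. Qed.

Definition alg_comp (K A B C : comPzRingType) (a : {rmorphism K -> A})
    (b : {rmorphism K -> B}) (c : {rmorphism K -> C})
    (g : alghom b c) (f : alghom a b) : alghom a c :=
  AlgHom (alg_comp_subproof g f).

Definition alg_iso (K A B : comPzRingType)
    (a : {rmorphism K -> A}) (b : {rmorphism K -> B}) :=
  exists f : alghom a b, bijective f.

Section ProductRing.
Variables (I : Type) (R : I -> comPzRingType).

Definition prod_ring : Type := forall i, R i.

HB.instance Definition _ := gen_eqMixin prod_ring.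
HB.instance Definition _ := gen_choiceMixin prod_ring.

Implicit Types f g h : prod_ring.
Let zero : prod_ring := fun=> 0.
Let one : prod_ring := fun=> 1.
Let opp f : prod_ring := fun i => - f i.
Let add f g : prod_ring := fun i => f i + g i.
Let mul f g : prod_ring := fun i => f i * g i.

Let addA : associative add.
Proof. by move=> f g h; apply: functional_extensionality_dep => i; exact: addrA. Qed.
Let addC : commutative add.
Proof. by move=> f g; apply: functional_extensionality_dep => i; exact: addrC. Qed.
Let add0 : left_id zero add.
Proof. by move=> f; apply: functional_extensionality_dep => i; exact: add0r. Qed.
Let addN : left_inverse zero opp add.
Proof. by move=> f; apply: functional_extensionality_dep => i; exact: addNr. Qed.

HB.instance Definition _ :=
  GRing.isZmodule.Build prod_ring addA addC add0 addN.

Let mulA : associative mul.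
Proof. by move=> f g h; apply: functional_extensionality_dep => i; exact: mulrA. Qed.
Let mulC : commutative mul.
Proof. by move=> f g; apply: functional_extensionality_dep => i; exact: mulrC. Qed.
Let mul1 : left_id one mul.
Proof. by move=> f; apply: functional_extensionality_dep => i; exact: mul1r. Qed.
Let mulD : left_distributive mul +%R.
Proof. by move=> f g h; apply: functional_extensionality_dep => i; exact: mulrDl. Qed.

HB.instance Definition _ :=
  GRing.Zmodule_isComPzRing.Build prod_ring mulA mulC mul1 mulD.

Definition prod_fun (A : comPzRingType) (f : forall i, {rmorphism A -> R i})
  (x : A) : prod_ring := fun i => f i x.

Variables (A : comPzRingType) (f : forall i, {rmorphism A -> R i}).

Lemma prod_fun_zmod : zmod_morphism (prod_fun f).
Proof. by move=> x y; apply: functional_extensionality_dep => i; exact: rmorphB. Qed.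
Lemma prod_fun_monoid : monoid_morphism (prod_fun f).
Proof.
by split=> [|x y]; apply: functional_extensionality_dep => i;
  [exact: rmorph1 | exact: rmorphM].
Qed.
HB.instance Definition _ :=
  GRing.isZmodMorphism.Build A prod_ring (prod_fun f) prod_fun_zmod.
HB.instance Definition _ :=
  GRing.isMonoidMorphism.Build A prod_ring (prod_fun f) prod_fun_monoid.

Definition prod_rmorphism : {rmorphism A -> prod_ring} := prod_fun f.

End ProductRing.

Definition is_ideal (R : comPzRingType) (J : pred R) :=
  zmod_closed J /\ forall a x, x \in J -> a * x \in J.

Record maximal_ideal (R : comPzRingType) := MaximalIdeal {
  mi_pred : R -> bool;
  mi_ideal : is_ideal mi_pred;
  mi_proper : 1 \notin mi_pred;
  mi_maximal : forall J : pred R, is_ideal J -> 1 \notin J ->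
    {subset mi_pred <= J} -> {subset J <= mi_pred} }.

(* Quotient.quot only has a ring structure over nontrivial rings, while R may
   be any comPzRingType here; the multiplication is added below. *)
Section QuotientRing.
Variables (R : comPzRingType) (m : maximal_ideal R).

HB.instance Definition _ :=
  GRing.isZmodClosed.Build R (mi_pred m) (mi_ideal m).1.

Definition mi_zmod : zmodClosed R := GRing.ZmodClosed.clone _ (mi_pred m) _.

Definition quot_ring : Type := Quotient.quot mi_zmod.
HB.instance Definition _ := GRing.Zmodule.on quot_ring.
HB.instance Definition _ : EqQuotient R (Quotient.equiv mi_zmod) quot_ring :=
  EqQuotient.on quot_ring.

Definition quot_map (x : R) : quot_ring := \pi_quot_ring x.
Let one : quot_ring := quot_map 1.
Let mul (x y : quot_ring) : quot_ring := quot_map (repr x * repr y).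

Lemma quot_mapK (x : quot_ring) : quot_map (repr x) = x.
Proof. exact: reprK. Qed.

Lemma quot_map_eqP x y :
  reflect (quot_map x = quot_map y) (x - y \in mi_pred m).
Proof. by rewrite [_ \in _](Quotient.idealrBE mi_zmod); exact: eqP. Qed.

Lemma quot_map_zmod : zmod_morphism quot_map.
Proof.
move=> x y; rewrite /quot_map.
by rewrite (Quotient.pi_add mi_zmod) (Quotient.pi_opp mi_zmod).
Qed.
HB.instance Definition _ :=
  GRing.isZmodMorphism.Build R quot_ring quot_map quot_map_zmod.

Let quot_mapM x y : quot_map (x * y) = mul (quot_map x) (quot_map y).
Proof.
apply/esym/quot_map_eqP.
set x' := repr _; set y' := repr _.
have xx' : x' - x \in mi_zmod by apply/quot_map_eqP; rewrite quot_mapK.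
have yy' : y' - y \in mi_zmod by apply/quot_map_eqP; rewrite quot_mapK.
have -> : x' * y' - x * y = x' * (y' - y) + y * (x' - x).
  by rewrite !mulrBr addrA (mulrC y x) (mulrC y x') addrNK.
by apply: (rpredD (S := mi_zmod)); apply: (mi_ideal m).2.
Qed.

Let mulA : associative mul.
Proof.
by move=> x y z; rewrite -[x]quot_mapK -[y]quot_mapK -[z]quot_mapK
  -!quot_mapM mulrA.
Qed.
Let mulC : commutative mul.
Proof. by move=> x y; rewrite /mul mulrC. Qed.
Let mul1 : left_id one mul.
Proof. by move=> x; rewrite -[x]quot_mapK /one -quot_mapM mul1r. Qed.
Let mulD : left_distributive mul +%R.
Proof.
by move=> x y z; rewrite -[x]quot_mapK -[y]quot_mapK -[z]quot_mapK
  -raddfD -!quot_mapM mulrDl raddfD.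
Qed.

HB.instance Definition _ :=
  GRing.Zmodule_isComPzRing.Build quot_ring mulA mulC mul1 mulD.

Lemma quot_map_monoid : monoid_morphism quot_map.
Proof. by split=> [|x y]; [|exact: quot_mapM]. Qed.
HB.instance Definition _ :=
  GRing.isMonoidMorphism.Build R quot_ring quot_map quot_map_monoid.

Definition quot_rmorphism : {rmorphism R -> quot_ring} := quot_map.

End QuotientRing.

(** * Separability *)

Definition separable_extension (K F : fieldType) (a : {rmorphism K -> F}) :=
  forall x, exists p : {poly K}, separable_poly p /\ root (map_poly a p) x.

Definition separably_closed (F : fieldType) :=
  forall p : {poly F}, separable_poly p -> (1 < size p)%N -> exists x, root p x.

Definition separable_closure (K F : fieldType) (a : {rmorphism K -> F}) :=
  separable_extension a /\ separably_closed F.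

Definition finite_extension (K F : fieldType) (a : {rmorphism K -> F}) :=
  exists (n : nat) (b : 'I_n -> F), forall x, exists c : 'I_n -> K,
    x = \sum_(i < n) a (c i) * b i.

Definition finite_separable (K F : fieldType) (a : {rmorphism K -> F}) :=
  finite_extension a /\ separable_extension a.

Definition finite_etale (K : fieldType) (A : comPzRingType)
    (a : {rmorphism K -> A}) :=
  exists (n : nat) (F : 'I_n -> fieldType) (b : forall i, {rmorphism K -> F i}),
    (forall i, finite_separable (b i)) /\ alg_iso a (prod_rmorphism b).

(** * The Galois group and its Krull topology *)

Record gal (K L : fieldType) (iota : {rmorphism K -> L}) := Gal {
  gal_alghom :> alghom iota iota;
  gal_bij : bijective gal_alghom }.

Section GaloisGroup.
Variables (K L : fieldType) (iota : {rmorphism K -> L}).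
Implicit Types (s t u : gal iota).

Lemma gal_eq s t : s =1 t -> s = t.
Proof.
case: s t => [s sb] [t tb] /= /alghom_eq st.
by rewrite st in sb *; congr Gal; exact: Prop_irrelevance.
Qed.

HB.instance Definition _ := gen_eqMixin (gal iota).
HB.instance Definition _ := gen_choiceMixin (gal iota).

Let one : gal iota :=
  Gal (Bijective (fun=> erefl) (fun=> erefl) : bijective (alg_id iota)).
Let mul s t : gal iota :=
  Gal (bij_comp (gal_bij s) (gal_bij t) : bijective (alg_comp s t)).

Let inv_subproof s : exists t, cancel s t /\ cancel t s.
Proof.
have [g gK Kg] := gal_bij s.
pose gz := GRing.isZmodMorphism.Build _ _ g (can2_zmod_morphism gK Kg).
pose gm := GRing.isMonoidMorphism.Build _ _ g (can2_monoid_morphism gK Kg).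
pose gr : {rmorphism L -> L} := HB.pack g gz gm.
have gi x : gr (iota x) = iota x.
  by rewrite -[X in gr X](alghomK (gal_alghom s)) [LHS]gK.
by exists (@Gal _ _ iota (AlgHom gi) (Bijective Kg gK)).
Qed.
Let inv s : gal iota := sval (cid (inv_subproof s)).

Let mulA : associative mul. Proof. by move=> s t u; exact: gal_eq. Qed.
Let mul1s : left_id one mul. Proof. by move=> s; exact: gal_eq. Qed.
Let muls1 : right_id one mul. Proof. by move=> s; exact: gal_eq. Qed.
Let mulVs : left_inverse one inv mul.
Proof.
by move=> s; apply: gal_eq => x; rewrite /inv /=; case: cid => t [/= st _];
  exact: st.
Qed.
Let mulsV : right_inverse one inv mul.
Proof.
by move=> s; apply: gal_eq => x; rewrite /inv /=; case: cid => t [/= _ ts];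
  exact: ts.
Qed.
HB.instance Definition _ :=
  isGroup.Build (gal iota) mulA mul1s muls1 mulVs mulsV.

Lemma galM s t x : (s * t)%g x = s (t x). Proof. by []. Qed.
Lemma gal1 x : (1%g : gal iota) x = x. Proof. by []. Qed.

(* The cosets s Gal(L/K(X)), X a finite subset of L, form a neighbourhood base
   at s. *)
Definition krull_nbhs (s : gal iota) : set_system (gal iota) :=
  [set U | exists X : seq L, forall t, {in X, t =1 s} -> U t].

HB.instance Definition _ := hasNbhs.Build (gal iota) krull_nbhs.

Let krull_filter s : ProperFilter (nbhs s).
Proof.
split; first by move=> [X /(_ s)]; apply.
split; first by exists [::].
  move=> U V [X XU] [Y YV]; exists (X ++ Y) => t ts.
  by split; [apply: XU | apply: YV] => x xX; apply: ts;
    rewrite mem_cat xX ?orbT.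
by move=> U V UV [X XU]; exists X => t /XU /UV.
Qed.
Let krull_singleton s (U : set (gal iota)) : nbhs s U -> U s.
Proof. by case=> X; apply. Qed.
Let krull_nbhs_nbhs s (U : set (gal iota)) : nbhs s U -> nbhs s (nbhs^~ U).
Proof.
case=> X XU; exists X => t ts; exists X => u ut; apply: XU => x xX.
by rewrite ut ?ts.
Qed.
HB.instance Definition _ := Nbhs_isNbhsTopological.Build (gal iota)
  krull_filter krull_singleton krull_nbhs_nbhs.

End GaloisGroup.

(** * Rational quivers *)

Record gquiver (K L : fieldType) (iota : {rmorphism K -> L}) := GQuiver {
  vertex : Type;
  edge : Type;
  src : edge -> vertex;
  tgt : edge -> vertex;
  actV : gal iota -> vertex -> vertex;
  actE : gal iota -> edge -> edge;
  actV1 : forall v, actV 1%g v = v;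
  actVM : forall g h v, actV (g * h)%g v = actV g (actV h v);
  actE1 : forall e, actE 1%g e = e;
  actEM : forall g h e, actE (g * h)%g e = actE g (actE h e);
  src_act : forall g e, src (actE g e) = actV g (src e);
  tgt_act : forall g e, tgt (actE g e) = actV g (tgt e) }.

Definition continuous_action (G : topologicalType) (X : Type)
    (act : G -> X -> X) :=
  continuous (fun p : G * discrete_topology {classic X} =>
    act p.1 p.2 : discrete_topology {classic X}).

Record rational_quiver (K L : fieldType) (iota : {rmorphism K -> L}) :=
  RationalQuiver {
    rq_quiver :> gquiver iota;
    rq_finV : finite_set [set: vertex rq_quiver];
    rq_finE : finite_set [set: edge rq_quiver];
    rq_contV : continuous_action (@actV _ _ _ rq_quiver);
    rq_contE : continuous_action (@actE _ _ _ rq_quiver) }.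

Definition split_quiver (K L : fieldType) (iota : {rmorphism K -> L})
    (Q : gquiver iota) :=
  (forall g (v : vertex Q), actV g v = v) /\
  (forall g (e : edge Q), actE g e = e).

Section QuiverCategory.
Variables (K L : fieldType) (iota : {rmorphism K -> L}).

Record quiver_hom (Q R : gquiver iota) := QuiverHom {
  qhV : vertex Q -> vertex R;
  qhE : edge Q -> edge R;
  qh_src : forall e, src (qhE e) = qhV (src e);
  qh_tgt : forall e, tgt (qhE e) = qhV (tgt e);
  qh_actV : forall g v, qhV (actV g v) = actV g (qhV v);
  qh_actE : forall g e, qhE (actE g e) = actE g (qhE e) }.

Lemma quiver_hom_eq Q R (f g : quiver_hom Q R) :
  qhV f = qhV g -> qhE f = qhE g -> f = g.
Proof.
case: f g => [fV fE f1 f2 f3 f4] [gV gE g1 g2 g3 g4] /= EV EE.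
by subst; congr QuiverHom; exact: Prop_irrelevance.
Qed.

Definition quiver_id Q : quiver_hom Q Q :=
  @QuiverHom Q Q id id (fun=> erefl) (fun=> erefl) (fun _ _ => erefl)
    (fun _ _ => erefl).

Definition quiver_comp Q R T (g : quiver_hom R T) (f : quiver_hom Q R) :
  quiver_hom Q T.
Proof.
by exists (qhV g \o qhV f) (qhE g \o qhE f) => [e|e|s v|s e] /=;
  rewrite ?qh_src ?qh_tgt ?qh_actV ?qh_actE.
Defined.

Let comp1 Q R (f : quiver_hom Q R) : quiver_comp (quiver_id R) f = f.
Proof. exact: quiver_hom_eq. Qed.
Let compc1 Q R (f : quiver_hom Q R) : quiver_comp f (quiver_id Q) = f.
Proof. exact: quiver_hom_eq. Qed.
Let compA Q R T U (h : quiver_hom T U) (g : quiver_hom R T)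
  (f : quiver_hom Q R) :
  quiver_comp h (quiver_comp g f) = quiver_comp (quiver_comp h g) f.
Proof. exact: quiver_hom_eq. Qed.

Definition quiver_category : category :=
  @Category (rational_quiver iota) quiver_hom quiver_id
    (fun _ _ _ => @quiver_comp _ _ _)
    (fun _ _ _ _ => @compA _ _ _ _) (fun _ _ => @comp1 _ _)
    (fun _ _ => @compc1 _ _).

Definition is_split_quiver (Q : quiver_category) : Prop :=
  split_quiver (rq_quiver Q).

End QuiverCategory.

(** * Etale species *)

Record species (K : fieldType) := Species {
  idx : Type;
  sfield : idx -> fieldType;
  sfieldK : forall i, {rmorphism K -> sfield i};
  sbimod : idx -> idx -> comPzRingType;
  sbimodK : forall i j, {rmorphism K -> sbimod i j};
  sleft : forall i j, alghom (sfieldK i) (sbimodK i j);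
  sright : forall i j, alghom (sfieldK j) (sbimodK i j) }.

Arguments sfieldK {K} _ _.
Arguments sbimodK {K} _ _ _.
Arguments sleft {K} _ _ _.
Arguments sright {K} _ _ _.

Record etale_species (K : fieldType) := EtaleSpecies {
  es_species :> species K;
  es_fin : finite_set [set: idx es_species];
  es_field : forall i, finite_separable (sfieldK es_species i);
  es_bimod : forall i j, finite_etale (sbimodK es_species i j) }.

(* An isomorphism of K-algebras between M_ij and a product of copies of K is
   automatically one of bialgebras, as L_i and L_j are isomorphic to K. *)
Definition split_species (K : fieldType) (S : species K) :=
  forall i j, alg_iso (idrm K) (sfieldK S i) /\
    exists n : nat,
      alg_iso (sbimodK S i j) (prod_rmorphism (fun _ : 'I_n => idrm K)).

Section SpeciesCategory.
Variable K : fieldType.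

(* The index map goes against the algebra maps, as it must for a morphism of
   species to induce a morphism of quivers. With an index map idx S -> idx T, the
   split species with one vertex and zero bimodule would be a terminal object
   with two morphisms to the split species with two vertices and zero bimodules,
   whereas no nonempty quiver maps to the initial, i.e. empty, one. *)
Record species_hom (S T : species K) := SpeciesHom {
  sh_idx : idx T -> idx S;
  sh_field : forall i, alghom (sfieldK S (sh_idx i)) (sfieldK T i);
  sh_bimod : forall i j,
    alghom (sbimodK S (sh_idx i) (sh_idx j)) (sbimodK T i j);
  sh_left : forall i j x,
    sh_bimod i j (sleft S _ _ x) = sleft T i j (sh_field i x);
  sh_right : forall i j x,
    sh_bimod i j (sright S _ _ x) = sright T i j (sh_field j x) }.

Lemma species_hom_eq S T (h : idx T -> idx S)
    (f f' : forall i, alghom (sfieldK S (h i)) (sfieldK T i))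
    (g g' : forall i j, alghom (sbimodK S (h i) (h j)) (sbimodK T i j)) l r l' r' :
  (forall i, f i =1 f' i) -> (forall i j, g i j =1 g' i j) ->
  @SpeciesHom S T h f g l r = @SpeciesHom S T h f' g' l' r'.
Proof.
move=> ff' gg'.
have E1 : f = f' by apply: functional_extensionality_dep => i; exact: alghom_eq.
have E2 : g = g'.
  by do 2![apply: functional_extensionality_dep => ?]; exact: alghom_eq.
by subst; congr SpeciesHom; exact: Prop_irrelevance.
Qed.

Definition species_id S : species_hom S S :=
  @SpeciesHom S S id (fun=> alg_id _) (fun _ _ => alg_id _)
    (fun _ _ _ => erefl) (fun _ _ _ => erefl).

Definition species_comp S T U (g : species_hom T U) (f : species_hom S T) :
  species_hom S U.
Proof.
exists (sh_idx f \o sh_idx g)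
  (fun i => alg_comp (sh_field g i) (sh_field f (sh_idx g i)))
  (fun i j => alg_comp (sh_bimod g i j) (sh_bimod f (sh_idx g i) (sh_idx g j))).
- by move=> i j x /=; rewrite !sh_left.
- by move=> i j x /=; rewrite !sh_right.
Defined.

Let comp1 S T (f : species_hom S T) : species_comp (species_id T) f = f.
Proof. by case: f => *; exact: species_hom_eq. Qed.
Let compc1 S T (f : species_hom S T) : species_comp f (species_id S) = f.
Proof. by case: f => *; exact: species_hom_eq. Qed.
Let compA S T U W (h : species_hom U W) (g : species_hom T U)
  (f : species_hom S T) :
  species_comp h (species_comp g f) = species_comp (species_comp h g) f.
Proof. exact: species_hom_eq. Qed.

Definition species_category : category :=
  @Category (etale_species K) species_hom species_id
    (fun _ _ _ => @species_comp _ _ _)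
    (fun _ _ _ _ => @compA _ _ _ _) (fun _ _ => @comp1 _ _)
    (fun _ _ => @compc1 _ _).

Definition is_split_species (S : species_category) : Prop :=
  split_species (es_species S).

End SpeciesCategory.

(** * The species of a rational quiver *)

Section FixedField.
Variables (K L : fieldType) (iota : {rmorphism K -> L}) (H : set (gal iota)).

Definition fixed_pred : L -> bool := fun x => `[< forall s, H s -> s x = x >].

Lemma fixed_predP x : reflect (forall s, H s -> s x = x) (x \in fixed_pred).
Proof. exact: asboolP. Qed.

Lemma fixed_divring_closed : divring_closed fixed_pred.
Proof.
split=> [|x y /fixed_predP fx /fixed_predP fy|x y /fixed_predP fx /fixed_predP fy];
  apply/fixed_predP => s Hs.
- exact: rmorph1.
- by rewrite rmorphB fx ?fy.
- by rewrite fmorph_div fx ?fy.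
Qed.
HB.instance Definition _ :=
  GRing.isDivringClosed.Build L fixed_pred fixed_divring_closed.

Record fixed_field := FixedField {
  ff_val :> L;
  ff_valP : ff_val \in fixed_pred }.

HB.instance Definition _ := [isSub for ff_val].
HB.instance Definition _ := [Choice of fixed_field by <:].
HB.instance Definition _ := [SubChoice_isSubIntegralDomain of fixed_field by <:].
HB.instance Definition _ := [SubIntegralDomain_isSubField of fixed_field by <:].

End FixedField.

Section FixedLift.
Variables (K L : fieldType) (iota : {rmorphism K -> L}) (H : set (gal iota)).
Variables (A : comPzRingType) (f : {rmorphism A -> L}).
Variable fH : forall x, f x \in fixed_pred H.

Definition fixed_fun (x : A) : fixed_field H := FixedField (fH x).
Lemma fixed_fun_zmod : zmod_morphism fixed_fun.
Proof. by move=> x y; apply: val_inj; exact: rmorphB. Qed.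
Lemma fixed_fun_monoid : monoid_morphism fixed_fun.
Proof. by split=> [|x y]; apply: val_inj; [exact: rmorph1 | exact: rmorphM]. Qed.
HB.instance Definition _ :=
  GRing.isZmodMorphism.Build A (fixed_field H) fixed_fun fixed_fun_zmod.
HB.instance Definition _ :=
  GRing.isMonoidMorphism.Build A (fixed_field H) fixed_fun fixed_fun_monoid.

Definition fixed_lift : {rmorphism A -> fixed_field H} := fixed_fun.
End FixedLift.

Section FixedAlgebra.
Variables (K L : fieldType) (iota : {rmorphism K -> L}).
Implicit Type H : set (gal iota).

Lemma fixedK_subproof H x : iota x \in fixed_pred H.
Proof. by apply/fixed_predP => s _; exact: alghomK. Qed.

Definition fixedK H : {rmorphism K -> fixed_field H} :=
  fixed_lift (@fixedK_subproof H).

Definition ff_rmorphism H : {rmorphism fixed_field H -> L} := val.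

Variables (H1 H2 : set (gal iota)) (s : gal iota).
Hypothesis sH : forall g, H2 g -> H1 (s^-1 * g * s)%g.

Lemma fixed_transport_subproof (x : fixed_field H1) :
  comprm s (ff_rmorphism H1) x \in fixed_pred H2.
Proof.
apply/fixed_predP => g /sH/(fixed_predP _ _ (ff_valP x)) /=.
by move=> {2}<-; rewrite -!galM !mulgA mulgV mul1g.
Qed.

Lemma fixed_transportK x :
  fixed_lift fixed_transport_subproof (fixedK H1 x) = fixedK H2 x.
Proof. by apply: val_inj; exact: alghomK. Qed.

Definition fixed_transport : alghom (fixedK H1) (fixedK H2) :=
  AlgHom fixed_transportK.

End FixedAlgebra.

Section QuiverSpecies.
Variables (K L : fieldType) (iota : {rmorphism K -> L}) (Q : gquiver iota).
Implicit Types (v w : vertex Q) (e : edge Q) (g : gal iota).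

Definition orbitV v : set (vertex Q) := [set w | exists g, w = actV g v].
Definition orbitE e : set (edge Q) := [set f | exists g, f = actE g e].
Definition orbitsV := {O : set (vertex Q) | exists v, O = orbitV v}.
Definition orbitsE := {O : set (edge Q) | exists e, O = orbitE e}.

Definition edges_between (i j : orbitsV) : set (edge Q) :=
  [set e | sval i (src e) /\ sval j (tgt e)].
Definition edge_orbits (i j : orbitsV) :=
  {eps : orbitsE | sval eps `<=` edges_between i j}.

Definition stabV v : set (gal iota) := [set g | actV g v = v].
Definition stabE e : set (gal iota) := [set g | actE g e = e].

Record representatives := Representatives {
  repV : orbitsV -> vertex Q;
  repV_in : forall i, sval i (repV i);
  repE : orbitsE -> edge Q;
  repE_in : forall eps, sval eps (repE eps);
  rep_sigma : orbitsE -> gal iota;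
  rep_tau : orbitsE -> gal iota;
  rep_src : forall i j (eps : edge_orbits i j),
    src (repE (sval eps)) = actV (rep_sigma (sval eps)) (repV i);
  rep_tgt : forall i j (eps : edge_orbits i j),
    tgt (repE (sval eps)) = actV (rep_tau (sval eps)) (repV j) }.

Variable r : representatives.

Lemma stab_src i j (eps : edge_orbits i j) g :
  let s := rep_sigma r (sval eps) in
  stabE (repE r (sval eps)) g -> stabV (repV r i) (s^-1 * g * s)%g.
Proof.
move=> s ge; rewrite /stabV /= !actVM -(rep_src r eps) -src_act ge.
by rewrite (rep_src r eps) -actVM mulVg actV1.
Qed.

Lemma stab_tgt i j (eps : edge_orbits i j) g :
  let t := rep_tau r (sval eps) in
  stabE (repE r (sval eps)) g -> stabV (repV r j) (t^-1 * g * t)%g.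
Proof.
move=> t ge; rewrite /stabV /= !actVM -(rep_tgt r eps) -tgt_act ge.
by rewrite (rep_tgt r eps) -actVM mulVg actV1.
Qed.

Definition qs_field (i : orbitsV) : fieldType := fixed_field (stabV (repV r i)).

Definition qs_fieldK (i : orbitsV) : {rmorphism K -> qs_field i} :=
  fixedK (stabV (repV r i)).

Definition qs_bimod (i j : orbitsV) : comPzRingType :=
  prod_ring (fun eps : edge_orbits i j =>
    fixed_field (stabE (repE r (sval eps))) : comPzRingType).

Definition qs_bimodK (i j : orbitsV) : {rmorphism K -> qs_bimod i j} :=
  prod_rmorphism (fun eps : edge_orbits i j =>
    fixedK (stabE (repE r (sval eps)))).

Definition qs_left (i j : orbitsV) : alghom (qs_fieldK i) (qs_bimodK i j).
Proof.
exists (prod_rmorphism (fun eps : edge_orbits i j =>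
  algf (fixed_transport (@stab_src i j eps)))) => x.
by apply: functional_extensionality_dep => eps; exact: alghomK.
Defined.

Definition qs_right (i j : orbitsV) : alghom (qs_fieldK j) (qs_bimodK i j).
Proof.
exists (prod_rmorphism (fun eps : edge_orbits i j =>
  algf (fixed_transport (@stab_tgt i j eps)))) => x.
by apply: functional_extensionality_dep => eps; exact: alghomK.
Defined.

Definition quiver_species : species K :=
  @Species K orbitsV qs_field qs_fieldK qs_bimod qs_bimodK qs_left qs_right.

End QuiverSpecies.

(** * The rational quiver of a species *)

Section SpeciesQuiver.
Variables (K L : fieldType) (iota : {rmorphism K -> L}) (S : species K).

Definition residueK (i j : idx S) (m : maximal_ideal (sbimod i j)) :
  {rmorphism K -> quot_ring m} := comprm (quot_rmorphism m) (sbimodK S i j).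

Definition residue (i j : idx S) (m : maximal_ideal (sbimod i j)) :
  alghom (sbimodK S i j) (residueK m) :=
  @AlgHom _ _ _ (sbimodK S i j) (residueK m) (quot_rmorphism m) (fun=> erefl).

Definition sq_vertex : Type := {i : idx S & alghom (sfieldK S i) iota}.

Record sq_edge := SqEdge {
  sq_i : idx S;
  sq_j : idx S;
  sq_ideal : maximal_ideal (sbimod sq_i sq_j);
  sq_hom : alghom (residueK sq_ideal) iota }.

Definition sq_src (e : sq_edge) : sq_vertex :=
  existT _ (sq_i e)
    (alg_comp (sq_hom e) (alg_comp (residue (sq_ideal e)) (sleft S _ _))).
Definition sq_tgt (e : sq_edge) : sq_vertex :=
  existT _ (sq_j e)
    (alg_comp (sq_hom e) (alg_comp (residue (sq_ideal e)) (sright S _ _))).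

Definition sq_actV (g : gal iota) (v : sq_vertex) : sq_vertex :=
  existT _ (projT1 v) (alg_comp g (projT2 v)).
Definition sq_actE (g : gal iota) (e : sq_edge) : sq_edge :=
  SqEdge (alg_comp g (sq_hom e)).

Definition species_quiver : gquiver iota.
Proof.
exists sq_vertex sq_edge sq_src sq_tgt sq_actV sq_actE.
- by case=> i f; congr existT; exact: alghom_eq.
- by move=> g h [i f]; congr existT; exact: alghom_eq.
- by case=> i j m f; congr SqEdge; exact: alghom_eq.
- by move=> g h [i j m f]; congr SqEdge; exact: alghom_eq.
- by move=> g [i j m f]; congr existT; exact: alghom_eq.
- by move=> g [i j m f]; congr existT; exact: alghom_eq.
Defined.

End SpeciesQuiver.

(* Main.v *)
From HB Require Import structures.
From mathcomp Require Import all_boot all_order all_algebra.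
From mathcomp Require Import fieldext separable.
From mathcomp Require Import boolp classical_sets functions cardinality topology.
Require Import Defs.

(** The quiver of a species is assembled from the sets Hom(A, L) of K-algebra
homomorphisms, where A runs through the fields L_i (vertices) and the bimodules
M_ij (edges: a homomorphism M_ij -> L has a maximal ideal as kernel, see
edge_of_hom). The theorem is therefore a form of Grothendieck's Galois theory,
by which A |-> Hom(A, L) is an anti-equivalence from finite etale K-algebras to
finite sets with a continuous action of the Galois group G.

Two facts are proved about the functor from species to quivers. It is fully
faithful: a finite etale A is the algebra of equivariant functions
Hom(A, L) -> L (etale_hom_separated, etale_hom_interpolation), so that an
equivariant map Hom(A, L) -> Hom(B, L) is composition with a unique homomorphism
B -> A (etale_hom_duality); the left and right structure maps are matched with
sources and targets. And every rational quiver Q is isomorphic to the quiver of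
its species, by the map that sends a vertex or edge g x, where x is the
representative of its orbit, to the embedding of the fixed field L(x) induced by
g (unit_vertex_bijective, unit_edge_bijective). For edges one also needs that a
homomorphism from a finite product of algebras to a field factors through one of
the factors (prod_hom_factor).

These two facts determine the functor from quivers to species on morphisms and
make the two functors quasi-inverse (quasi_inverse_of_fully_faithful). They
restrict to split objects because the fixed field of G is K, and because the
homomorphisms from a product of copies of K to L take values in K.

The field theory behind this is the Galois correspondence for a separable
closure L of K, infinite in general: partial embeddings into L extend by
Zorn's lemma (alghom_extension), which makes G transitive on the embeddings of an
extension (gal_transitive); the group fixing a subfield F has fixed field F
(fixed_by_pointwise_stabilizer); and an open subgroup is the group fixing its
fixed field, which is finite over K (open_subgroup_closed,
fixed_field_finite_separable). *)

Set Implicit Arguments.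
Unset Strict Implicit.
Unset Printing Implicit Defensive.

Import GRing.Theory.

Local Open Scope classical_set_scope.
Local Open Scope ring_scope.

(** * Algebra homomorphisms and polynomials *)

Definition make_rmorphism (A B : comPzRingType) (f : A -> B)
    (fB : zmod_morphism f) (fM : monoid_morphism f) : {rmorphism A -> B} :=
  HB.pack f (GRing.isZmodMorphism.Build A B f fB)
    (GRing.isMonoidMorphism.Build A B f fM).

Lemma alghom_eq_app (K A B : comPzRingType) (a : {rmorphism K -> A})
  (b : {rmorphism K -> B}) (f g : alghom a b) : f = g -> f =1 g.
Proof. by move=> ->. Qed.

Lemma alghom_inverse (K A B : comPzRingType) (a : {rmorphism K -> A})
    (b : {rmorphism K -> B}) (f : alghom a b) : bijective f ->
  exists g : alghom b a, cancel f g /\ cancel g f.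
Proof.
case=> g gK Kg.
pose gr := make_rmorphism (can2_zmod_morphism gK Kg) (can2_monoid_morphism gK Kg).
have grK x : gr (b x) = a x by rewrite -(alghomK f) /= gK.
by exists (AlgHom grK).
Qed.

Lemma map_poly_alghom (K E F : fieldType) (a : {rmorphism K -> E})
    (b : {rmorphism K -> F}) (f : alghom a b) p :
  map_poly f (map_poly a p) = map_poly b p.
Proof.
by rewrite -map_poly_comp; apply: eq_map_poly => k; rewrite /= alghomK.
Qed.

Lemma root_alghom (K E F : fieldType) (a : {rmorphism K -> E})
    (b : {rmorphism K -> F}) (f : alghom a b) p x :
  root (map_poly b p) (f x) = root (map_poly a p) x.
Proof. by rewrite -(map_poly_alghom f) fmorph_root. Qed.

Section Subfield.
Variables (E : fieldType) (P : divringClosed E).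

(** The domain of a partial embedding is a subset of a field known only through a
predicate; this type makes it a field of its own, so that polynomials over it
and its rmorphisms are available. *)
Record subfield := Subfield { sf_val :> E; sf_valP : sf_val \in P }.

HB.instance Definition _ := [isSub for sf_val].
HB.instance Definition _ := [Choice of subfield by <:].
HB.instance Definition _ := [SubChoice_isSubIntegralDomain of subfield by <:].
HB.instance Definition _ := [SubIntegralDomain_isSubField of subfield by <:].

Definition sf_rmorphism : {rmorphism subfield -> E} := val.

End Subfield.

Section Separable.
Variables (K E : fieldType) (a : {rmorphism K -> E}).
Hypothesis sepE : separable_extension a.

(** The inverse of an algebraic x lies in K[x]: dividing a polynomial vanishing
at x by a power of the variable makes its constant term c nonzero, and then
c + x s(x) = 0 exhibits - s(x) / c as the inverse. *)
Lemma inverse_is_poly (x : E) : x != 0 ->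
  exists s : {poly K}, (map_poly a s).[x] * x = 1.
Proof.
move=> x0; have [p [/separable_poly_neq0 p0 px]] := sepE x.
(* Here q is p with all factors of the variable removed. *)
have [m [q]] := multiplicity_XsubC p 0; rewrite p0 /= => q0 defp.
have {px} qx : root (map_poly a q) x.
  move: px; rewrite defp rmorphM rmorphXn rmorphB /= map_polyX map_polyC /=.
  rewrite rmorph0 rootM => /orP[//|].
  by rewrite rootE subr0 hornerXn expf_eq0 (negPf x0) andbF.
have [s defs] : exists s, q - q.[0]%:P = s * ('X - 0%:P).
  by apply/factor_theorem; rewrite rootE hornerD hornerN hornerC subrr.
exists (- (q.[0]^-1) *: s); rewrite map_polyZ hornerZ /= rmorphN fmorphV.
have /(congr1 (fun r : {poly K} => (map_poly a r).[x])) := defs.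
rewrite rmorphM !rmorphB /= map_polyX !map_polyC /= rmorph0 subr0 hornerM.
rewrite hornerX hornerD hornerN (rootP qx) hornerC sub0r => e.
by rewrite -mulrA -e mulrNN mulVf // fmorph_eq0.
Qed.

End Separable.

(** Minimal polynomials without a finiteness assumption on the ambient field:
if q does not divide some p vanishing at x, then gcd(p, q) is a proper divisor
of q that still vanishes at x, and divisors of separable polynomials are
separable. *)
Lemma separable_minpoly (F E : fieldType) (i : {rmorphism F -> E}) (x : E)
    (q : {poly F}) : separable_poly q -> root (map_poly i q) x ->
  exists m, [/\ separable_poly m, root (map_poly i m) x &
    forall p, root (map_poly i p) x -> m %| p].
Proof.
move=> qsep qx.
have [n] := ubnP (size q); elim: n q qsep qx => // n IH q qsep qx leqn.
have q0 := separable_poly_neq0 qsep.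
have [qmin|nmin] := pselect (forall p, root (map_poly i p) x -> q %| p).
  by exists q.
have [p px pq] : exists2 p, root (map_poly i p) x & ~ q %| p.
  apply: contrapT => /forall2NP np; apply: nmin => p px.
  by have [//|/contrapT] := np p.
pose d := gcdp p q.
have dq : d %| q by apply: dvdp_gcdr.
apply: (IH d); first exact: dvdp_separable dq qsep.
  by rewrite gcdp_map root_gcd px.
rewrite -ltnS; apply: leq_trans leqn; rewrite ltnS ltn_neqAle dvdp_leq // andbT.
apply/negP => /(_ =P _) e; apply: pq.
have : d %= q by rewrite -dvdp_size_eqp // e.
by move/eqp_dvdl <-; apply: dvdp_gcdl.
Qed.

(** The point y to which x may be sent when the embedding f of F is extended to
F(x): a root in L of the image under f of the minimal polynomial of x. *)
Lemma conjugate_root (F E L : fieldType) (i : {rmorphism F -> E})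
    (f : {rmorphism F -> L}) (x : E) (q : {poly F}) :
    separably_closed L -> separable_poly q -> root (map_poly i q) x ->
  exists y, forall p, root (map_poly i p) x -> root (map_poly f p) y.
Proof.
move=> Lsc qsep qx; have [m [msep mx mmin]] := separable_minpoly qsep qx.
have := root_size_gt1 _ mx; rewrite map_poly_eq0 size_map_poly.
move/(_ (separable_poly_neq0 msep)) => ms.
have [||y fmy] := Lsc (map_poly f m); rewrite ?separable_map ?size_map_poly //.
exists y => p /mmin; rewrite -(dvdp_map f) => fmp.
by rewrite -dvdp_XsubCl; apply: dvdp_trans fmp; rewrite dvdp_XsubCl.
Qed.

Lemma poly_roots (L : fieldType) (p : {poly L}) : p != 0 ->
  exists s : seq L, forall x, (x \in s) = root p x.
Proof.
have [n] := ubnP (size p); elim: n p => // n IH p szp p0.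
have [[x px]|nroot] := pselect (exists x, root p x); last first.
  by exists [::] => x; rewrite in_nil; apply/esym/negP => px; apply: nroot; exists x.
have [q defp] := factor_theorem _ _ px.
have q0 : q != 0 by apply: contraNneq p0 => q0; rewrite defp q0 mul0r.
have [||s sP] := IH q => //.
  rewrite -ltnS (leq_trans _ szp) // defp size_Mmonic ?monicXsubC //.
  by rewrite size_XsubC addn2.
by exists (x :: s) => y; rewrite in_cons sP defp rootM root_XsubC orbC.
Qed.

(** * Extending partial embeddings into a separably closed field *)

Section Graph.
Variables (K E L : fieldType) (a : {rmorphism K -> E}) (b : {rmorphism K -> L}).
Hypothesis sepE : separable_extension a.

(** The graph of a K-algebra homomorphism into L defined on a K-subalgebra of E.
Graphs are ordered by inclusion, nonempty chains of graphs have graphs as unions,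
and so Zorn's lemma applies to them. Stability under inverses follows, as E is
algebraic over K. *)
Record alg_graph (R : E * L -> Prop) := AlgGraph {
  agK : forall k, R (a k, b k);
  agB : forall x y x' y', R (x, y) -> R (x', y') -> R (x - x', y - y');
  agM : forall x y x' y', R (x, y) -> R (x', y') -> R (x * x', y * y');
  ag0 : forall y, R (0, y) -> y = 0 }.

Section Domain.
Variables (R : set (E * L)) (gR : alg_graph R).

Lemma agD x y x' y' : R (x, y) -> R (x', y') -> R (x + x', y + y').
Proof.
move=> xy xy'; rewrite -[x']opprK -[y']opprK.
apply: agB => //; rewrite -[- x']sub0r -[- y']sub0r; apply: agB => //.
by have := agK gR 0; rewrite !rmorph0.
Qed.

Lemma ag_horner x y (p : {poly K}) :
  R (x, y) -> R ((map_poly a p).[x], (map_poly b p).[y]).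
Proof.
move=> xy; elim/poly_ind: p => [|p c IH].
  by have := agK gR 0; rewrite !rmorph0 !horner0.
rewrite !(rmorphD, rmorphM) /= !map_polyX !map_polyC /= !hornerMXaddC.
by apply: agD; [apply: agM | apply: agK].
Qed.

Lemma ag_fun x y y' : R (x, y) -> R (x, y') -> y = y'.
Proof.
move=> xy xy'; apply/eqP; rewrite -subr_eq0; apply/eqP/(ag0 gR).
by rewrite -[0](subrr x); apply: agB.
Qed.

(** By inverse_is_poly the inverse of x is s(x) for some s over K; the graph
contains (s(x), s(y)) and (s(x) x, s(y) y), so s(y) y = 1 too. *)
Lemma agV x y : R (x, y) -> R (x^-1, y^-1).
Proof.
move=> xy; have [x0|x0] := eqVneq x 0.
  by move: xy; rewrite x0 => /(ag0 gR) ->; have := agK gR 0; rewrite !rmorph0 !invr0.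
have [s sx] := inverse_is_poly sepE x0.
have sxy := ag_horner s xy.
have sy : (map_poly b s).[y] * y = 1.
  apply: (@ag_fun 1); first by rewrite -sx; apply: agM.
  by rewrite -(rmorph1 a) -(rmorph1 b); apply: agK.
have -> : x^-1 = (map_poly a s).[x] by apply: mulr1_eq; rewrite mulrC.
by have -> : y^-1 = (map_poly b s).[y] by apply: mulr1_eq; rewrite mulrC.
Qed.

Definition ag_dom : E -> bool := fun x => `[< exists y, R (x, y) >].

Lemma ag_domP x : reflect (exists y, R (x, y)) (x \in ag_dom).
Proof. exact: asboolP. Qed.

Lemma ag_dom_divring_closed : divring_closed ag_dom.
Proof.
split=> [|x x' /ag_domP[y xy] /ag_domP[y' xy']|x x' /ag_domP[y xy] /ag_domP[y' xy']];
  apply/ag_domP.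
- by exists (b 1); rewrite -(rmorph1 a); apply: agK.
- by exists (y - y'); apply: agB.
- by exists (y / y'); apply: agM => //; apply: agV.
Qed.
HB.instance Definition _ :=
  GRing.isDivringClosed.Build E ag_dom ag_dom_divring_closed.

Definition ag_divring : divringClosed E := GRing.DivringClosed.clone _ ag_dom _.

Definition ag_field : fieldType := subfield ag_divring.

Definition ag_map (x : ag_field) : L := sval (cid (ag_domP _ (sf_valP x))).

Lemma ag_mapP (x : ag_field) : R (val x, ag_map x).
Proof. by rewrite /ag_map; case: cid. Qed.

Lemma ag_map_zmod : zmod_morphism ag_map.
Proof.
move=> x y; apply: (ag_fun (ag_mapP _)); rewrite rmorphB.
by apply: agB => //; apply: ag_mapP.
Qed.
Lemma ag_map_monoid : monoid_morphism ag_map.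
Proof.
split=> [|x y]; apply: (ag_fun (ag_mapP _)); rewrite ?rmorphM ?rmorph1.
  by rewrite -(rmorph1 a) -(rmorph1 b); apply: agK.
by apply: agM => //; apply: ag_mapP.
Qed.
Definition ag_rmorphism := make_rmorphism ag_map_zmod ag_map_monoid.

Lemma ag_fieldK_subproof k : a k \in ag_dom.
Proof. by apply/ag_domP; exists (b k); apply: agK. Qed.
Definition ag_fieldK_fun k : ag_field := Subfield (ag_fieldK_subproof k).
Lemma ag_fieldK_zmod : zmod_morphism ag_fieldK_fun.
Proof. by move=> x y; apply: val_inj; rewrite rmorphB /= rmorphB. Qed.
Lemma ag_fieldK_monoid : monoid_morphism ag_fieldK_fun.
Proof.
by split=> [|x y]; apply: val_inj; rewrite ?rmorphM ?rmorph1 /= ?rmorphM ?rmorph1.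
Qed.
Definition ag_fieldK := make_rmorphism ag_fieldK_zmod ag_fieldK_monoid.

(** A graph extends to a graph defined at x: the pairs (p(x), p(y)) form one, y
being a conjugate of x over the domain. *)
Lemma ag_extend x : separably_closed L ->
  exists R' : set (E * L), [/\ R `<=` R', alg_graph R' & exists y, R' (x, y)].
Proof.
move=> Lsc; pose i : {rmorphism ag_field -> E} := sf_rmorphism ag_divring.
have [q [qsep qx]] := sepE x.
have [||y yP] := @conjugate_root _ _ _ i ag_rmorphism x (map_poly ag_fieldK q) Lsc.
- by rewrite separable_map.
- by rewrite -map_poly_comp.
pose R' : set (E * L) := [set u | exists p : {poly ag_field},
  u = ((map_poly i p).[x], (map_poly ag_rmorphism p).[y])].
have RR' : R `<=` R'.
  move=> [z t] zt; have zd : z \in ag_dom by apply/ag_domP; exists t.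
  exists (Subfield zd)%:P; rewrite !map_polyC /= !hornerC /=; congr pair.
  exact: ag_fun zt (ag_mapP (Subfield zd)).
exists R'; split => //; last first.
  by exists y; exists 'X; rewrite !map_polyX !hornerX.
split.
- by move=> k; apply: RR'; apply: (agK gR).
- move=> _ _ _ _ [p [-> ->]] [p' [-> ->]]; exists (p - p').
  by rewrite !rmorphB /= !hornerD !hornerN.
- move=> _ _ _ _ [p [-> ->]] [p' [-> ->]]; exists (p * p').
  by rewrite !rmorphM /= !hornerM.
- by move=> z [p [/esym/rootP/yP/rootP pr ->]].
Qed.

End Domain.

(** A maximal graph containing R0 is defined everywhere, by ag_extend. *)
Lemma alghom_extension (R0 : set (E * L)) :
    separably_closed L -> alg_graph R0 ->
  exists f : alghom a b, forall x y, R0 (x, y) -> f x = y.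
Proof.
move=> Lsc gR0; pose P : set (set (E * L)) := [set R | alg_graph (R0 `|` R)].
(* Taking the union with R0 makes the empty chain harmless. *)
have [F FP Ftot|R [gR Rmax]] := @Zorn_bigcup _ P.
  have two u v : (R0 `|` \bigcup_(X in F) X) u -> (R0 `|` \bigcup_(X in F) X) v ->
      exists Y, [/\ alg_graph Y, Y u, Y v & Y `<=` R0 `|` \bigcup_(X in F) X].
    have sub X : F X -> R0 `|` X `<=` R0 `|` \bigcup_(X in F) X.
      by move=> FX; apply: setUS; exact: bigcup_sup.
    move=> [u0|[X FX Xu]] [v0|[Y FY Yv]].
    - by exists R0; split => //; exact: subsetUl.
    - by exists (R0 `|` Y); split; [exact: FP|left|right|exact: sub].
    - by exists (R0 `|` X); split; [exact: FP|right|left|exact: sub].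
    - have [XY|YX] := Ftot _ _ FX FY.
        by exists (R0 `|` Y); split; [exact: FP|right; apply: XY|right|exact: sub].
      by exists (R0 `|` X); split; [exact: FP|right|right; apply: YX|exact: sub].
  split.
  - by move=> k; left; apply: agK.
  - move=> x y x' y' xy xy'; have [Y [gY Yxy Yxy' sY]] := two _ _ xy xy'.
    by apply: sY; exact: agB.
  - move=> x y x' y' xy xy'; have [Y [gY Yxy Yxy' sY]] := two _ _ xy xy'.
    by apply: sY; exact: agM.
  - by move=> y /[dup] u /two -/(_ _ u)[Y [gY Yu _ _]]; exact: (ag0 gY).
have tot x : x \in ag_dom (R0 `|` R).
  apply/ag_domP; have [R' [RR' gR' [y xy]]] := ag_extend gR x Lsc.
  have [R'R|nR'R] := pselect (R' `<=` R); first by exists y; right; apply: R'R.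
  have [] := Rmax R'.
    by split=> // t Rt; apply: RR'; right.
  rewrite /P /=; suff -> : R0 `|` R' = R' by [].
  by apply: setUidr => t R0t; apply: RR'; left.
pose f x := ag_map (gR:=gR) (Subfield (tot x)).
have fP x : (R0 `|` R) (x, f x) by exact: (ag_mapP (gR := gR) (Subfield (tot x))).
have fz : zmod_morphism f.
  by move=> x y; apply: (ag_fun gR (fP _)); apply: agB.
have fm : monoid_morphism f.
  split=> [|x y]; apply: (ag_fun gR (fP _)); last by apply: agM.
  by rewrite -(rmorph1 a) -(rmorph1 b); apply: agK.
pose fr := make_rmorphism fz fm.
have frK k : fr (a k) = b k by apply: (ag_fun gR (fP _)); apply: agK.
exists (AlgHom frK) => x y xy; apply: (ag_fun gR (fP _)); by left.
Qed.

End Graph.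

Lemma embedding_exists (K E L : fieldType) (a : {rmorphism K -> E})
    (b : {rmorphism K -> L}) :
  separable_extension a -> separably_closed L -> inhabited (alghom a b).
Proof.
move=> sepE Lsc; pose R0 : set (E * L) := [set u | exists k, u = (a k, b k)].
have [|f _] := @alghom_extension _ _ _ a b sepE R0 Lsc; last by split.
split.
- by move=> k; exists k.
- by move=> _ _ _ _ [k [-> ->]] [l [-> ->]]; exists (k - l); rewrite !rmorphB.
- by move=> _ _ _ _ [k [-> ->]] [l [-> ->]]; exists (k * l); rewrite !rmorphM.
- by move=> y [k [/esym/eqP]]; rewrite fmorph_eq0 => /eqP -> ->; rewrite rmorph0.
Qed.

(** * Galois theory of a separable closure *)

Section Galois.
Variables (K L : fieldType) (iota : {rmorphism K -> L}).
Hypothesis Lsc : separable_closure iota.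

Let sepL : separable_extension iota := Lsc.1.

(** An endomorphism is injective, hence permutes the finitely many roots in L of
each polynomial over K; every element of L is such a root. *)
Lemma alghom_endo_bij (f : alghom iota iota) : bijective f.
Proof.
have finj : injective f by exact: fmorph_inj.
suff surj y : exists x, f x = y.
  have [g gK] := choice surj.
  by exists g => // x; apply: finj; rewrite gK.
have [p [/separable_poly_neq0 p0 py]] := sepL y.
have [|s sP] := @poly_roots _ (map_poly iota p); first by rewrite map_poly_eq0.
have us := undup_uniq s; pose t := undup s.
have fs : {subset map f t <= t}.
  by move=> _ /mapP[x + ->]; rewrite !mem_undup !sP root_alghom.
have : y \in map f t.
  have [||_ ->] := uniq_min_size _ fs; rewrite ?map_inj_uniq ?size_map //.
  by rewrite mem_undup sP.
by case/mapP => x _ ->; exists x.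
Qed.

Definition gal_of_endo (f : alghom iota iota) : gal iota := Gal (alghom_endo_bij f).

(** The pairs (f x, f' x) form a graph on L, and an extension of it to L is
an automorphism by alghom_endo_bij. *)
Lemma gal_transitive (E : fieldType) (a : {rmorphism K -> E})
    (f f' : alghom a iota) : exists s : gal iota, f' = alg_comp s f.
Proof.
pose R0 : set (L * L) := [set u | exists x, u = (f x, f' x)].
have [|g gP] := @alghom_extension _ _ _ iota iota sepL R0 Lsc.2.
  split.
  - by move=> k; exists (a k); rewrite !alghomK.
  - by move=> _ _ _ _ [x [-> ->]] [y [-> ->]]; exists (x - y); rewrite !rmorphB.
  - by move=> _ _ _ _ [x [-> ->]] [y [-> ->]]; exists (x * y); rewrite !rmorphM.
  - by move=> y [x [/esym/eqP]]; rewrite fmorph_eq0 => /eqP -> ->; rewrite rmorph0.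
exists (gal_of_endo g); apply: alghom_eq => x /=.
by apply/esym/gP; exists x.
Qed.

(** Half of the Galois correspondence: the fixed field of the group fixing i(F)
is i(F). If x is not in i(F), then its minimal polynomial m over F has degree at
least 2 and, being separable, has a root y other than x in L; the partial
embedding p(x) |-> p(y) of F(x) extends to an automorphism that moves x. *)
Lemma fixed_by_pointwise_stabilizer (F : fieldType) (a : {rmorphism K -> F})
    (i : alghom a iota) x :
  (forall s : gal iota, (forall y, s (i y) = i y) -> s x = x) -> exists y, x = i y.
Proof.
move=> fixx; apply: contrapT => /forallNP nx.
have [q [qsep qx]] := sepL x.
rewrite -(map_poly_alghom i) in qx.
have [||m [msep mx mmin]] := @separable_minpoly _ _ i x (map_poly a q).
- by rewrite separable_map.
- by [].
have m0 := separable_poly_neq0 msep.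
have [r defm] := factor_theorem _ _ mx.
have r0 : r != 0.
  by apply: contraTneq m0 => r0; rewrite -(map_poly_eq0 i) defm r0 mul0r eqxx.
(* If r were a constant c, then m would be linear with root x. *)
have rs : (1 < size r)%N.
  rewrite ltnNge; apply/negP => /size1_polyC; move: r`_0 => c er.
  have c0 : c != 0 by rewrite -polyC_eq0 -er.
  have e1 : i m`_1 = c.
    by rewrite -coef_map defm er coefCM coefB coefX coefC /= subr0 mulr1.
  have e0 : i m`_0 = - c * x.
    by rewrite -coef_map defm er coefCM coefB coefX coefC /= sub0r mulrN mulNr.
  apply: (nx (- (m`_0 / m`_1))).
  by rewrite rmorphN fmorph_div /= e0 e1 mulNr mulNr opprK mulrAC mulfV // mul1r.
have sepim : separable_poly (map_poly i m) by rewrite separable_map.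
have [||y ry] := Lsc.2 r => //.
  by apply: dvdp_separable sepim; rewrite defm dvdp_mulr.
have yx : y != x.
  apply: contraTneq sepim => yx; move: ry; rewrite yx defm => rx.
  by rewrite separable_root rx andbF.
have my : root (map_poly i m) y by rewrite defm rootM ry.
pose R0 : set (L * L) :=
  [set u | exists p : {poly F}, u = ((map_poly i p).[x], (map_poly i p).[y])].
have [|f fP] := @alghom_extension _ _ _ iota iota sepL R0 Lsc.2.
  split.
  - by move=> k; exists (a k)%:P; rewrite !map_polyC /= !hornerC alghomK.
  - move=> _ _ _ _ [p [-> ->]] [p' [-> ->]]; exists (p - p').
    by rewrite !rmorphB /= !hornerD !hornerN.
  - move=> _ _ _ _ [p [-> ->]] [p' [-> ->]]; exists (p * p').
    by rewrite !rmorphM /= !hornerM.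
  - move=> z [p [/esym/rootP/mmin]]; rewrite -(dvdp_map i) => mp ->.
    by apply/rootP; rewrite -dvdp_XsubCl; apply: dvdp_trans mp; rewrite dvdp_XsubCl.
have fx : f x = y by apply: fP; exists 'X; rewrite !map_polyX !hornerX.
move/eqP: yx; apply; rewrite -fx; apply: (fixx (gal_of_endo f)) => z.
by apply: fP; exists z%:P; rewrite !map_polyC /= !hornerC.
Qed.

End Galois.

(** * Finite subextensions and open subgroups *)

(** Among the matrices with all rows in C, one of maximal rank spans C, since
adding to it a vector of C outside its row space would raise the rank. *)
Lemma subspace_row_space (K : fieldType) n (C : set 'rV[K]_n) :
    C 0 -> (forall k c d, C c -> C d -> C (k *: c + d)) ->
  exists A : 'M[K]_n, forall c, C c <-> (c <= A)%MS.
Proof.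
move=> C0 CD.
have rowC (A : 'M[K]_n) c : (forall k, C (row k A)) -> (c <= A)%MS -> C c.
  move=> AC /submxP[d ->]; rewrite mulmx_sum_row.
  elim/big_rec: _ => [//|k v _ Cv]; exact: CD.
pose P r := `[< exists A : 'M[K]_n, (forall k, C (row k A)) /\ \rank A = r >].
have exP : exists r, P r.
  exists 0%N; apply/asboolP; exists 0; split; last exact: mxrank0.
  by move=> k; rewrite row0.
have Pn r : P r -> (r <= n)%N by move=> /asboolP[A [_ <-]]; exact: rank_leq_row.
case: (ex_maxnP exP Pn) => r /asboolP[A [AC rA]] rmax.
exists A => c; split; last exact: rowC.
move=> Cc; apply: contrapT => /negP cA.
pose B := (A + c)%MS.
have : P (\rank B).
  apply/asboolP; exists B; split=> // k.
  have /sub_addsmxP[[u v] /= ->] : (row k B <= A + c)%MS by exact: row_sub.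
  rewrite -[u *m A]scale1r; apply: (CD); first by apply: rowC (submxMl _ _).
  rewrite (mx11_scalar v) mul_scalar_mx -[_ *: c]addr0; exact: CD.
move=> /rmax; rewrite -rA leqNgt => /negP; apply.
rewrite ltn_neqAle mxrankS ?addsmxSl // andbT.
apply: contra cA => rAc; have := mxrank_leqif_sup (addsmxSl A c).
by move=> [_]; rewrite rAc addsmx_sub => /esym/andP[].
Qed.

(** With respect to a spanning family of F, the coefficient vectors of the
elements of j(E) form a subspace; preimages of the combinations given by the
rows of a matrix spanning that subspace span E. *)
Lemma finite_extension_sub (K E F : fieldType) (a : {rmorphism K -> E})
    (b : {rmorphism K -> F}) (j : alghom a b) :
  finite_extension b -> finite_extension a.
Proof.
move=> [n [e eP]].
pose lc (c : 'rV[K]_n) := \sum_(k < n) b (c 0 k) * e k.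
have lcD k c d : lc (k *: c + d) = b k * lc c + lc d.
  rewrite /lc mulr_sumr -big_split; apply: eq_bigr => l _.
  by rewrite !mxE rmorphD rmorphM mulrDl mulrA.
have [||A AP] := @subspace_row_space K n [set c | exists x, j x = lc c].
- by exists 0; rewrite /lc big1 ?rmorph0 // => k _; rewrite mxE rmorph0 mul0r.
- move=> k c d [x xc] [y yd]; exists (a k * x + y).
  by rewrite rmorphD rmorphM alghomK lcD xc yd.
have /choice[x xP] k : exists x, j x = lc (row k A) by apply/AP/row_sub.
exists n, x => z; have [c zc] := eP (j z).
have /AP/submxP[d dP] : exists x, j x = lc (\row_k c k).
  by exists z; rewrite zc; apply: eq_bigr => k _; rewrite mxE.
exists (d 0); apply: (fmorph_inj j); rewrite zc rmorph_sum.
transitivity (lc (d *m A)).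
  by rewrite -dP; apply: eq_bigr => k _; rewrite mxE.
rewrite mulmx_sum_row; elim/big_rec2: _ => [|k y v _ yv].
  by rewrite /lc big1 // => k _; rewrite mxE rmorph0 mul0r.
by rewrite lcD yv rmorphM alghomK xP.
Qed.

Lemma finite_extension_fin (K F : fieldType) (a : {rmorphism K -> F})
    (J : finType) (e : J -> F) :
  (forall x, exists c : J -> K, x = \sum_j a (c j) * e j) -> finite_extension a.
Proof.
move=> eP; exists #|J|, (e \o enum_val) => x; have [c ->] := eP x.
by exists (c \o enum_val); rewrite (reindex _ (onW_bij _ (@enum_val_bij J))).
Qed.

Lemma finite_extension_trans (K F E : fieldType) (a : {rmorphism K -> F})
    (b : {rmorphism F -> E}) :
  finite_extension a -> finite_extension b -> finite_extension (comprm b a).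
Proof.
move=> [n [e eP]] [m [d dP]].
apply: (@finite_extension_fin _ _ _ _ (fun u : 'I_m * 'I_n => b (e u.2) * d u.1)).
move=> x; have [c ->] := dP x; have /choice[g gP] k := eP (c k).
exists (fun u => g u.1 u.2).
rewrite -(pair_bigA _ (fun k l => (comprm b a) (g k l) * (b (e l) * d k))) /=.
apply: eq_bigr => k _; rewrite (gP k) rmorph_sum mulr_suml.
by apply: eq_bigr => l _; rewrite rmorphM mulrA.
Qed.

Section OpenSubgroups.
Variables (K L : fieldType) (iota : {rmorphism K -> L}).
Hypothesis Lsc : separable_closure iota.

Let sepL : separable_extension iota := Lsc.1.

(** Adjoining the elements of X one at a time, as F[t]/(p), gives a finite
extension whose image contains X. *)
Lemma finite_subextension (X : seq L) :
  exists (F : fieldType) (a : {rmorphism K -> F}) (i : alghom a iota),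
    finite_extension a /\ forall x, x \in X -> exists y, i y = x.
Proof.
elim: X => [|x X [F [a [i [fina iX]]]]].
  exists K, (idrm K), (@AlgHom _ _ _ (idrm K) iota iota (fun=> erefl)); split=> //.
  by exists 1%N, (fun=> 1) => x; exists (fun=> x); rewrite big_ord1 mulr1.
have [q [/separable_poly_neq0 q0 qx]] := sepL x.
pose p := map_poly a q.
have p0 : p != 0 by rewrite map_poly_eq0.
have px : root (map_poly i p) x by rewrite map_poly_alghom.
pose F' : fieldType := subFExtend i x p.
pose b : {rmorphism F -> F'} := inj_subfx i x p.
pose j : {rmorphism F' -> L} := @subfx_inj F L i x p.
have jE (r : {poly F}) : j (subfx_eval i x p r) = (map_poly i r).[x].
  exact: subfx_inj_eval.
have jK k : j (comprm b a k) = iota k.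
  by rewrite /= jE map_polyC hornerC /= alghomK.
exists F', (comprm b a), (AlgHom jK); split; last first.
  move=> y; rewrite inE => /predU1P[->|/iX[z <-]].
    by exists (subfx_eval i x p 'X); rewrite /= jE map_polyX hornerX.
  by exists (b z); rewrite /= jE map_polyC hornerC.
apply: finite_extension_trans => //.
(* The powers of x below the size of p span; reduce representatives modulo p. *)
exists (size p), (fun k => subfx_eval i x p 'X^k) => y.
have [r ->] := subfxE y; exists (fun k => (r %% p)`_k).
apply: (fmorph_inj j); rewrite rmorph_sum jE.
rewrite {1}(divp_eq r p) rmorphD rmorphM hornerD hornerM (rootP px) mulr0 add0r.
rewrite -{1}(coefK (r %% p)) poly_def.
rewrite (@horner_coef_wide _ (size p)); last first.
  by rewrite -poly_def coefK size_map_poly ltnW // ltn_modp.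
rewrite -poly_def coefK; apply: eq_bigr => k _.
by rewrite rmorphM !jE map_polyC hornerC map_polyXn hornerXn coef_map.
Qed.

(** The conjugates of each entry of X are among the roots of one polynomial. *)
Lemma conjugates_finite (X : seq L) :
  exists l : seq (seq L), forall s : gal iota, map s X \in l.
Proof.
elim: X => [|x X [l lP]]; first by exists [:: [::]].
have [q [/separable_poly_neq0 q0 qx]] := sepL x.
have [|r rP] := @poly_roots _ (map_poly iota q); first by rewrite map_poly_eq0.
exists [seq y :: w | y <- r, w <- l] => s /=; apply: allpairs_f => //.
by rewrite rP root_alghom.
Qed.

Definition fixed_emb (H : set (gal iota)) : alghom (fixedK H) iota :=
  @AlgHom _ _ _ (fixedK H) iota (ff_rmorphism H) (fun=> erefl).

Section Subgroup.
Variables (H : set (gal iota)) (X : seq L).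
Hypothesis H1 : H 1%g.
Hypothesis HM : forall g h, H g -> H h -> H (g * h)%g.
Hypothesis HV : forall g, H g -> H g^-1%g.
Hypothesis HX : forall g : gal iota, {in X, forall x, g x = x} -> H g.

(** The other half of the Galois correspondence, for an open subgroup H
containing the automorphisms that fix X. Encode X as the polynomial a with
coefficient sequence X. The product P of the Y - h(a) over the finitely many
conjugates h(a), for h in H, has coefficients fixed by H. If g fixes the fixed
field of H, then g fixes P, so that g(a) is again a root of P and equals some
h(a); thus h^-1 g fixes X and belongs to H. *)
Lemma open_subgroup_closed (g : gal iota) :
  (forall x, x \in fixed_pred H -> g x = x) -> H g.
Proof.
move=> gfix.
have [l lP] := conjugates_finite X.
pose S := undup [seq w <- l | `[< exists2 h, H h & w = map h X >]].
have SP w : reflect (exists2 h, H h & w = map h X) (w \in S).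
  rewrite mem_undup mem_filter; apply: (iffP andP) => [[/asboolP//]|[h Hh ->]].
  by split=> //; apply/asboolP; exists h.
pose P : {poly {poly L}} := \prod_(w <- S) ('X - (Poly w)%:P).
have Pfix h : H h -> map_poly (map_poly h) P = P.
  move=> Hh; rewrite rmorph_prod /=.
  transitivity (\prod_(w <- [seq map h w | w <- S]) ('X - (Poly w)%:P)).
    rewrite big_map; apply: eq_bigr => w _.
    rewrite rmorphB /= map_polyX map_polyC /=; congr ('X - _%:P).
    apply/polyP => k; rewrite coef_map !coef_Poly.
    have [kw|kw] := ltnP k (size w); first by rewrite (nth_map 0).
    by rewrite !nth_default ?size_map //; exact: rmorph0.
  apply: perm_big; apply: uniq_perm; rewrite ?undup_uniq //.
    by rewrite map_inj_uniq ?undup_uniq //; apply: inj_map; apply: fmorph_inj.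
  move=> w; apply/idP/idP.
    case/mapP => _ /SP[u Hu ->] ->; apply/SP; exists (h * u)%g; first exact: HM.
    by rewrite -map_comp.
  case/SP => u Hu ->; apply/mapP; exists (map (h^-1 * u)%g X).
    by apply/SP; exists (h^-1 * u)%g => //; apply: HM => //; apply: HV.
  by rewrite -map_comp; apply: eq_map => x /=; rewrite -galM mulgV.
have gP : map_poly (map_poly g) P = P.
  apply/polyP => m; apply/polyP => k; rewrite !coef_map /=; apply: gfix.
  apply/fixed_predP => h /Pfix/(congr1 (fun Q : {poly {poly L}} => Q`_m`_k)).
  by rewrite !coef_map.
have rX : root P (Poly (map g X)).
  rewrite -[Poly _](_ : map_poly g (Poly X) = _); last first.
    apply/polyP => k; rewrite coef_map !coef_Poly.
    have [kX|kX] := ltnP k (size X); first by rewrite (nth_map 0).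
    by rewrite !nth_default ?size_map //; exact: rmorph0.
  apply/rootP; rewrite -gP horner_map; apply/eqP; rewrite map_poly_eq0.
  rewrite -[_ == _]/(root _ _) /P -(big_map (@Poly L) xpredT (fun u => 'X - u%:P)).
  by rewrite root_prod_XsubC; apply/map_f/SP; exists 1%g; rewrite ?map_id_in.
move: rX; rewrite /P -(big_map (@Poly L) xpredT (fun u => 'X - u%:P)).
rewrite root_prod_XsubC => /mapP[_ /SP[h Hh ->]] e.
have gh : {in X, forall x, g x = h x}.
  move=> x xX; have := congr1 (fun p : {poly L} => p`_(index x X)) e.
  by rewrite !coef_Poly !(nth_map 0) ?index_mem // !nth_index.
have -> : g = (h * (h^-1 * g))%g by rewrite mulgA mulgV mul1g.
by apply: HM => //; apply: HX => x /gh gx; rewrite galM gx -galM mulVg.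
Qed.

(** The fixed field of H is contained in that of the automorphisms fixing X,
which lies in any F whose image contains X, by
fixed_by_pointwise_stabilizer. *)
Lemma fixed_field_finite_separable : finite_separable (fixedK H).
Proof.
split; last first.
  move=> x; have [p [psep px]] := sepL (val x); exists p; split=> //.
  by rewrite -(root_alghom (fixed_emb H)).
have [F [a [i [fina iX]]]] := finite_subextension X.
have /choice[j jP] (x : fixed_field H) : exists y, val x = i y.
  apply: (fixed_by_pointwise_stabilizer Lsc) => s si.
  apply/(fixed_predP _ _ (ff_valP x))/HX => _ /iX[y <-]; exact: si.
have jz : zmod_morphism j.
  by move=> x y; apply: (fmorph_inj i); rewrite rmorphB -!jP.
have jm : monoid_morphism j.
  by split=> [|x y]; apply: (fmorph_inj i); rewrite ?rmorphM ?rmorph1 -!jP.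
pose jr := make_rmorphism jz jm.
have jK k : jr (fixedK H k) = a k by apply: (fmorph_inj i); rewrite alghomK -jP.
exact: finite_extension_sub (AlgHom jK) fina.
Qed.

End Subgroup.
End OpenSubgroups.

(** * Duality for finite etale algebras *)

Lemma finite_inj (X Y : Type) (f : X -> Y) :
  injective f -> finite_set [set: Y] -> finite_set [set: X].
Proof.
move=> finj Yfin; rewrite -(preimage_setT f); apply: finite_preimage => //.
exact: in2W.
Qed.

Lemma finite_enum (I : Type) : finite_set [set: I] ->
  exists n (u : 'I_n -> I), injective u /\ forall i, exists k, u k = i.
Proof.
move=> /(@finite_seqP {classic I})[s sP].
have us := undup_uniq s; pose t : seq {classic I} := undup s.
exists (size t), (fun k => tnth (in_tuple t) k); split.
  exact/(tuple_uniqP (in_tuple t)).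
move=> i; have : (i : {classic I}) \in t.
  by rewrite mem_undup; have : [set: {classic I}] i by []; rewrite sP.
by move=> /(tnthP (in_tuple t))[k ->]; exists k.
Qed.

Section ProductHoms.
Variables (I : Type) (R : I -> comPzRingType).
Hypothesis Ifin : finite_set [set: I].

(** Otherwise each index i would have a z_i vanishing at i with f(z_i) nonzero;
the product of the z_i is zero, whereas its image under f is not. *)
Lemma prod_hom_component (L : fieldType) (f : {rmorphism prod_ring R -> L}) :
  exists i, forall x y : prod_ring R, x i = y i -> f x = f y.
Proof.
apply: contrapT => /forallNP nf.
have /choice[z zP] i : exists z : prod_ring R, z i = 0 /\ f z != 0.
  have := nf i; rewrite -existsNE => -[x]; rewrite -existsNE => -[y].
  move=> /not_implyP[xy fxy]; exists (x - y); split.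
    by rewrite -[LHS]/(x i - y i) xy subrr.
  by rewrite rmorphB subr_eq0; apply/eqP.
have [n [u [_ uP]]] := finite_enum Ifin.
have P0 : \prod_k z (u k) = 0.
  apply: functional_extensionality_dep => i; have [k <-] := uP i.
  rewrite (bigD1 k) //=; set Q := \prod_(_ | _) _.
  by rewrite -[LHS]/(z (u k) (u k) * Q (u k)) (zP _).1 mul0r.
have /negP[] : f (\prod_k z (u k)) != 0.
  by rewrite rmorph_prod; apply/prodf_neq0 => k _; exact: (zP _).2.
by rewrite P0 rmorph0.
Qed.

(** The i-th factor is a quotient of the product and not a subalgebra. This
section, unital only at i, still induces a morphism once composed with a
homomorphism that depends on the i-th component alone. *)
Definition prod_single i (y : R i) : prod_ring R := fun j =>
  if pselect (i = j) is left e then eq_rect i R y j e else 0.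

Lemma prod_singleE i (y : R i) : prod_single y i = y.
Proof.
by rewrite /prod_single; case: pselect => // e; rewrite (Prop_irrelevance e erefl).
Qed.

Lemma prod_hom_factor (K L : fieldType) (iota : {rmorphism K -> L})
    (b : forall i, {rmorphism K -> R i}) (f : alghom (prod_rmorphism b) iota) :
  exists i (g : alghom (b i) iota), forall x, f x = g (x i).
Proof.
have [i fi] := prod_hom_component f.
pose g (y : R i) := f (prod_single y).
have gz : zmod_morphism g.
  move=> x y; rewrite /g -rmorphB; apply: fi.
  by rewrite -[RHS]/(prod_single x i - prod_single y i) !prod_singleE.
have gm : monoid_morphism g.
  split=> [|x y]; rewrite /g.
    by rewrite -(rmorph1 f); apply: fi; rewrite prod_singleE.
  rewrite -rmorphM; apply: fi.
  by rewrite -[RHS]/(prod_single x i * prod_single y i) !prod_singleE.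
pose gr := make_rmorphism gz gm.
have gK k : gr (b i k) = iota k.
  by rewrite -(alghomK f); apply: fi; rewrite prod_singleE.
by exists i, (AlgHom gK) => x; apply: fi; rewrite prod_singleE.
Qed.

End ProductHoms.

Definition alg_proj (K : comPzRingType) (I : Type) (R : I -> comPzRingType)
    (b : forall i, {rmorphism K -> R i}) (i : I) : alghom (prod_rmorphism b) (b i) :=
  @AlgHom _ _ _ (prod_rmorphism b) (b i)
    (@make_rmorphism (prod_ring R) (R i) (fun x => x i)
      (fun _ _ => erefl) (conj erefl (fun _ _ => erefl))) (fun=> erefl).

Section EtaleDuality.
Variables (K L : fieldType) (iota : {rmorphism K -> L}).
Hypothesis Lsc : separable_closure iota.

Section Field.
Variables (F : fieldType) (a : {rmorphism K -> F}).
Hypothesis Ffin : finite_separable a.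

Lemma hom_determined : exists n (e : 'I_n -> F),
  forall f g : alghom a iota, (forall k, f (e k) = g (e k)) -> f = g.
Proof.
have [[n [e eP]] _] := Ffin; exists n, e => f g fg; apply: alghom_eq => x.
have [c ->] := eP x; rewrite !rmorph_sum; apply: eq_bigr => k _.
by rewrite !rmorphM !alghomK fg.
Qed.

Lemma finite_homs_field : finite_set [set: alghom a iota].
Proof.
have [n [e eP]] := hom_determined.
(* A homomorphism sends each generator to a root of its polynomial. *)
have /choice[r rP] k : exists r : seq L, forall f : alghom a iota, f (e k) \in r.
  have [p [/separable_poly_neq0 p0 pe]] := Ffin.2 (e k).
  have [|s sP] := @poly_roots _ (map_poly iota p); first by rewrite map_poly_eq0.
  by exists s => f; rewrite sP root_alghom.
pose t := flatten [seq r k | k <- enum 'I_n].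
have tP k (f : alghom a iota) : f (e k) \in t.
  by apply/flattenP; exists (r k) => //; apply: map_f; rewrite mem_enum.
pose h (f : alghom a iota) : {ffun 'I_n -> seq_sub t} := [ffun k => SeqSub (tP k f)].
have hinj : injective h.
  move=> f g /ffunP fg; apply: eP => k.
  by have := congr1 val (fg k); rewrite !ffunE.
apply: finite_inj hinj _; exact: finite_finset.
Qed.

Lemma open_stabilizer_field (f : alghom a iota) :
  exists X : seq L, forall s : gal iota, {in X, forall x, s x = x} -> alg_comp s f = f.
Proof.
have [n [e eP]] := hom_determined; exists [seq f (e k) | k <- enum 'I_n] => s sX.
by apply: eP => k; rewrite /= sX //; apply: map_f; rewrite mem_enum.
Qed.

End Field.

Variables (A : comPzRingType) (a : {rmorphism K -> A}).
Hypothesis Aet : finite_etale a.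

(** A presentation of A as a product of fields, in the form in which it is used:
A is separated by its projections, has elements with any prescribed
components, and every homomorphism to L factors through a projection. *)
Lemma etale_hom_components : exists n (F : 'I_n -> fieldType)
    (b : forall k, {rmorphism K -> F k}) (p : forall k, alghom a (b k)),
  [/\ forall k, finite_separable (b k),
      forall x y, (forall k, p k x = p k y) -> x = y,
      forall z : forall k, F k, exists x, forall k, p k x = z k &
      forall f : alghom a iota, exists k (g : alghom (b k) iota), f = alg_comp g (p k)].
Proof.
have [n [F [b [bfin [phi phi_bij]]]]] := Aet.
have [psi [phiK psiK]] := alghom_inverse phi_bij.
exists n, F, b, (fun k => alg_comp (alg_proj b k) phi); split=> //.
- move=> x y xy; apply: (can_inj phiK); apply: functional_extensionality_dep.
  exact: xy.
- by move=> z; exists (psi z) => k /=; rewrite psiK.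
- move=> f; have [|k [g gP]] := prod_hom_factor _ (alg_comp f psi).
    exact: finite_finset.
  by exists k, g; apply: alghom_eq => x; rewrite /= -gP /= phiK.
Qed.

(** Each field factor of A embeds into L. *)
Lemma etale_hom_separated x y : (forall f : alghom a iota, f x = f y) -> x = y.
Proof.
have [n [F [b [p [bfin pinj _ _]]]]] := etale_hom_components.
move=> fxy; apply: pinj => k.
have [g] := embedding_exists iota (bfin k).2 Lsc.2.
by apply: (fmorph_inj g); have := fxy (alg_comp g (p k)).
Qed.

(** Galois descent: A is the algebra of equivariant functions on Hom(A, L). It
suffices to treat one embedding e of each factor, since the others are
conjugate to it; the value of c at e is fixed by the automorphisms fixing the
image of e, hence belongs to that image. *)
Lemma etale_hom_interpolation (c : alghom a iota -> L) :
    (forall (s : gal iota) (f : alghom a iota), c (alg_comp s f) = s (c f)) ->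
  exists x, forall f : alghom a iota, f x = c f.
Proof.
have [n [F [b [p [bfin _ psurj pfac]]]]] := etale_hom_components.
move=> cs.
have emb k : {e : alghom (b k) iota | True}.
  by apply: cid; have [e] := embedding_exists iota (bfin k).2 Lsc.2; exists e.
pose e k := sval (emb k).
have z k : {z : F k | c (alg_comp (e k) (p k)) = e k z}.
  apply: cid; apply: (fixed_by_pointwise_stabilizer Lsc) => s se.
  by rewrite -cs; congr c; apply: alghom_eq => x; rewrite /= se.
have [x xP] := psurj (fun k => sval (z k)); exists x => f.
have [k [g ->]] := pfac f; have [s ->] := gal_transitive Lsc (e k) g.
rewrite -[RHS](_ : c (alg_comp s (alg_comp (e k) (p k))) = _); last first.
  by congr c; apply: alghom_eq.
by rewrite cs (svalP (z k)) /= xP.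
Qed.

Lemma finite_homs : finite_set [set: alghom a iota].
Proof.
have [n [F [b [p [bfin _ _ pfac]]]]] := etale_hom_components.
apply: (@sub_finite_set _ _ (\bigcup_(k in [set: 'I_n])
    ((fun g : alghom (b k) iota => alg_comp g (p k)) @` setT))).
  by move=> f _; have [k [g ->]] := pfac f; exists k => //; exists g.
apply: bigcup_finite; first exact: finite_finset.
by move=> k _; apply: finite_image; apply: finite_homs_field.
Qed.

Lemma open_stabilizer (f : alghom a iota) :
  exists X : seq L, forall s : gal iota, {in X, forall x, s x = x} -> alg_comp s f = f.
Proof.
have [n [F [b [p [bfin _ _ pfac]]]]] := etale_hom_components.
have [k [g ->]] := pfac f; have [X XP] := open_stabilizer_field (bfin k) g.
exists X => s /XP sg; rewrite -[in RHS]sg; exact: alghom_eq.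
Qed.

(** Full faithfulness of A |-> Hom(A, L): for each x in B the function
f |-> c(f)(x) is equivariant, so it is evaluation at an element of A. *)
Lemma etale_hom_duality (B : comPzRingType) (b : {rmorphism K -> B})
    (c : alghom a iota -> alghom b iota) :
    (forall (s : gal iota) (f : alghom a iota), c (alg_comp s f) = alg_comp s (c f)) ->
  exists g : alghom b a, forall f, c f = alg_comp f g.
Proof.
move=> cs.
have /choice[g gP] x : exists y, forall f : alghom a iota, f y = c f x.
  by apply: etale_hom_interpolation => s f; rewrite cs.
have gz : zmod_morphism g.
  by move=> x y; apply: etale_hom_separated => f; rewrite rmorphB !gP rmorphB.
have gm : monoid_morphism g.
  split=> [|x y]; apply: etale_hom_separated => f.
    by rewrite gP !rmorph1.
  by rewrite rmorphM !gP rmorphM.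
pose gr := make_rmorphism gz gm.
have gK k : gr (b k) = a k.
  by apply: etale_hom_separated => f; rewrite gP !alghomK.
by exists (AlgHom gK) => f; apply: alghom_eq => x; rewrite /= gP.
Qed.

End EtaleDuality.

(** * Edges of the quiver of a species *)

Lemma maximal_ideal_eq (R : comPzRingType) (m n : maximal_ideal R) :
  mi_pred m =1 mi_pred n -> m = n.
Proof.
case: m n => [m m1 m2 m3] [n n1 n2 n3] /= /funext mn; subst n.
by congr MaximalIdeal; exact: Prop_irrelevance.
Qed.

Lemma existT_inj (I : Type) (T : I -> Type) (i : I) (x y : T i) :
  existT T i x = existT T i y -> x = y.
Proof.
move=> xy; have := projT2_eq xy.
by rewrite (Prop_irrelevance (projT1_eq xy) erefl).
Qed.

Section Kernel.
Variables (K L : fieldType) (iota : {rmorphism K -> L}).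
Hypothesis sepL : separable_extension iota.
Variables (A : comPzRingType) (a : {rmorphism K -> A}) (f : alghom a iota).

Definition kernel_pred : A -> bool := fun x => f x == 0.

Lemma kernelP x : reflect (f x = 0) (x \in kernel_pred).
Proof. exact: eqP. Qed.

Lemma kernel_is_ideal : is_ideal kernel_pred.
Proof.
split; first split=> [|x y /kernelP fx /kernelP fy].
- by apply/kernelP; rewrite rmorph0.
- by apply/kernelP; rewrite rmorphB fx fy subrr.
- by move=> x y /kernelP fy; apply/kernelP; rewrite rmorphM fy mulr0.
Qed.

Lemma kernel_proper : 1 \notin kernel_pred.
Proof. by apply/kernelP; rewrite rmorph1; apply/eqP; rewrite oner_eq0. Qed.

(** The inverse of f(x) is a polynomial in f(x) over K, so it is the image of
that polynomial in x. Evaluation at x is written out as a sum, since the type of A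
admits the zero ring. *)
Lemma alghom_inverse_image x : f x != 0 -> exists y, f (y * x) = 1.
Proof.
move=> /(inverse_is_poly sepL)[s <-]; exists (\sum_(k < size s) a s`_k * x ^+ k).
rewrite rmorphM rmorph_sum; congr (_ * _).
rewrite horner_coef size_map_poly; apply: eq_bigr => k _.
by rewrite rmorphM rmorphXn alghomK coef_map.
Qed.

(** The image of f is a field, since L is algebraic over K. *)
Lemma kernel_maximal (J : pred A) : is_ideal J -> 1 \notin J ->
  {subset kernel_pred <= J} -> {subset J <= kernel_pred}.
Proof.
move=> [[J0 JB] JM] J1 kJ x xJ; apply: contraNT J1 => /negP fx.
have [|y yx] := @alghom_inverse_image x; first by apply/negP.
have yxJ : y * x \in J by exact: JM.
rewrite -[1](subKr (y * x)); apply: JB => //; apply: kJ.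
by apply/kernelP; rewrite rmorphB yx rmorph1 subrr.
Qed.

Definition kernel : maximal_ideal A :=
  MaximalIdeal kernel_is_ideal kernel_proper kernel_maximal.

Definition kernel_fun (x : quot_ring kernel) : L := f (repr x).

Lemma kernel_funE x : kernel_fun (quot_map kernel x) = f x.
Proof.
apply/eqP; rewrite -subr_eq0 -rmorphB.
suff : repr (quot_map kernel x) - x \in mi_pred kernel by [].
by apply/quot_map_eqP; rewrite quot_mapK.
Qed.

Lemma kernel_fun_zmod : zmod_morphism kernel_fun.
Proof.
by move=> x y; rewrite -[x]quot_mapK -[y]quot_mapK -rmorphB !kernel_funE rmorphB.
Qed.
Lemma kernel_fun_monoid : monoid_morphism kernel_fun.
Proof.
split=> [|x y]; first by rewrite -(rmorph1 (quot_map kernel)) kernel_funE rmorph1.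
by rewrite -[x]quot_mapK -[y]quot_mapK -rmorphM !kernel_funE rmorphM.
Qed.
Definition kernel_rmorphism := make_rmorphism kernel_fun_zmod kernel_fun_monoid.

End Kernel.

Section SpeciesEdges.
Variables (K L : fieldType) (iota : {rmorphism K -> L}).
Hypothesis sepL : separable_extension iota.
Variable S : species K.

Definition edge_hom (e : sq_edge iota S) : alghom (sbimodK S (sq_i e) (sq_j e)) iota :=
  alg_comp (sq_hom e) (residue (sq_ideal e)).

Lemma edge_of_hom_subproof i j (f : alghom (sbimodK S i j) iota) k :
  kernel_rmorphism sepL f (residueK (kernel sepL f) k) = iota k.
Proof. by rewrite /= kernel_funE alghomK. Qed.

(** An edge from i to j amounts to a homomorphism from the bimodule M_ij to L:
its maximal ideal is the kernel. This makes edges accessible to the duality for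
finite etale algebras. *)
Definition edge_of_hom i j (f : alghom (sbimodK S i j) iota) : sq_edge iota S :=
  @SqEdge K L iota S i j (kernel sepL f) (AlgHom (edge_of_hom_subproof f)).

Lemma edge_of_homK i j (f : alghom (sbimodK S i j) iota) : edge_hom (edge_of_hom f) = f.
Proof. by apply: alghom_eq => x /=; exact: kernel_funE. Qed.

(** A maximal ideal is recovered as the kernel of the composite homomorphism to L,
so that two edges with the same composite have the same ideal. *)
Lemma sq_edge_eq i j (m m' : maximal_ideal (@sbimod K S i j))
    (h : alghom (residueK m) iota) (h' : alghom (residueK m') iota) :
  (forall x, h (quot_map m x) = h' (quot_map m' x)) ->
  (SqEdge h : sq_edge iota S) = SqEdge h'.
Proof.
move=> hh'; have mm' : m = m'.
  have kerE (n : maximal_ideal (@sbimod K S i j)) (g : alghom (residueK n) iota) :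
      n = kernel sepL (alg_comp g (residue n)).
    apply: maximal_ideal_eq => x; apply/idP/idP => [nx|].
      apply/kernelP => /=; suff -> : quot_map n x = 0 by rewrite rmorph0.
      by rewrite -(rmorph0 (quot_map n)); apply/quot_map_eqP; rewrite subr0.
    set f := alg_comp _ _.
    apply: (@mi_maximal _ n _ (kernel_is_ideal f) (kernel_proper f)) => y ny.
    apply/kernelP => /=; suff -> : quot_map n y = 0 by rewrite rmorph0.
    by rewrite -(rmorph0 (quot_map n)); apply/quot_map_eqP; rewrite subr0.
  rewrite (kerE m h) (kerE m' h'); congr kernel; exact: alghom_eq.
subst m'; congr SqEdge; apply: alghom_eq => x.
by rewrite -[x]quot_mapK hh'.
Qed.

Lemma edge_homK (e : sq_edge iota S) : edge_of_hom (edge_hom e) = e.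
Proof.
by case: e => i j m h; apply: sq_edge_eq => x /=; rewrite kernel_funE.
Qed.

Lemma edge_of_hom_exists (e : sq_edge iota S) i j :
  sq_i e = i -> sq_j e = j -> exists f : alghom (sbimodK S i j) iota, e = edge_of_hom f.
Proof. by move=> <- <-; exists (edge_hom e); rewrite edge_homK. Qed.

Lemma edge_of_hom_inj i j : injective (@edge_of_hom i j).
Proof.
move=> f g fg; pose T (u : idx S * idx S) := alghom (sbimodK S u.1 u.2) iota.
pose h e : {u & T u} := existT T (sq_i e, sq_j e) (edge_hom e).
have hE (f' : alghom (sbimodK S i j) iota) : h (edge_of_hom f') = existT T (i, j) f'.
  by rewrite -[in RHS](edge_of_homK f').
by apply: (@existT_inj _ T (i, j)); rewrite -!hE fg.
Qed.

Lemma sq_actE_edge_of_hom i j (f : alghom (sbimodK S i j) iota) (g : gal iota) :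
  sq_actE g (edge_of_hom f) = edge_of_hom (alg_comp g f).
Proof.
rewrite -[LHS]edge_homK; congr edge_of_hom; apply: alghom_eq => x /=.
by rewrite kernel_funE.
Qed.

Lemma src_edge_of_hom i j (f : alghom (sbimodK S i j) iota) :
  sq_src (edge_of_hom f) = existT _ i (alg_comp f (sleft S i j)).
Proof. by congr existT; apply: alghom_eq => x /=; rewrite kernel_funE. Qed.

Lemma tgt_edge_of_hom i j (f : alghom (sbimodK S i j) iota) :
  sq_tgt (edge_of_hom f) = existT _ j (alg_comp f (sright S i j)).
Proof. by congr existT; apply: alghom_eq => x /=; rewrite kernel_funE. Qed.

End SpeciesEdges.

(** * The functor from species to quivers *)

Section Continuity.
Variables (K L : fieldType) (iota : {rmorphism K -> L}).
Variables (X : Type) (act : gal iota -> X -> X).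
Hypothesis act1 : forall x, act 1%g x = x.
Hypothesis actM : forall g h x, act (g * h)%g x = act g (act h x).

(** For a discrete X, continuity says that each stabilizer contains the
automorphisms fixing some finite subset of L. *)
Lemma continuous_actionP : continuous_action act <->
  forall x, exists Y : seq L, forall g : gal iota,
    {in Y, forall y, g y = y} -> act g x = x.
Proof.
split=> [cont x|ost].
  have [|[U V] /= [[Y YU] Vx] UV] := cont (1%g, x) [set x].
    by rewrite /= act1; exact: discrete_set1.
  exists Y => g gY; apply: (UV (g, x)); split=> /=; first exact: YU.
  by move: Vx; rewrite nbhs_principalE => /principal_filterP.
move=> [g x] W; rewrite nbhs_principalE => /principal_filterP /= Wgx.
have [Y YP] := ost x.
exists ([set h : gal iota | {in Y, h =1 g}], [set x]).
  by split; [exists Y|exact: discrete_set1].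
move=> [h _] [/= hg ->].
suff -> : act h x = act g x by [].
have -> : h = (g * (g^-1 * h))%g by rewrite mulgA mulgV mul1g.
by rewrite actM YP // => y /hg hy; rewrite galM hy -galM mulVg.
Qed.

End Continuity.

Section SpeciesToQuiver.
Variables (K L : fieldType) (iota : {rmorphism K -> L}).
Hypothesis Lsc : separable_closure iota.

Let sepL : separable_extension iota := Lsc.1.

Lemma field_finite_etale (F : fieldType) (a : {rmorphism K -> F}) :
  finite_separable a -> finite_etale a.
Proof.
move=> Ffin; exists 1%N, (fun=> F), (fun=> a); split=> //.
pose f := prod_rmorphism (fun _ : 'I_1 => idrm F).
have fK k : f (a k) = prod_rmorphism (fun _ : 'I_1 => a) k by [].
exists (AlgHom fK), (fun x => x ord0) => // x.
by apply: functional_extensionality_dep => k; rewrite (ord1 k).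
Qed.

Section Objects.
Variable S : etale_species K.

Lemma species_quiver_finV : finite_set [set: vertex (species_quiver iota S)].
Proof.
apply: (@sub_finite_set _ _ (\bigcup_(i in [set: idx S])
    (existT (fun i => alghom (sfieldK S i) iota) i @` setT))).
  by move=> [i f] _; exists i => //; exists f.
apply: bigcup_finite; first exact: es_fin.
move=> i _; apply: finite_image; apply: finite_homs => //.
by apply: field_finite_etale; exact: es_field.
Qed.

Lemma species_quiver_finE : finite_set [set: edge (species_quiver iota S)].
Proof.
apply: (@sub_finite_set _ _ (\bigcup_(i in [set: idx S]) \bigcup_(j in [set: idx S])
    ((fun f : alghom (sbimodK S i j) iota => edge_of_hom sepL f) @` setT))).
  move=> e _; exists (sq_i e) => //; exists (sq_j e) => //.
  by exists (edge_hom e) => //; exact: edge_homK.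
apply: bigcup_finite => [|i _]; first exact: es_fin.
apply: bigcup_finite => [|j _]; first exact: es_fin.
by apply: finite_image; apply: finite_homs => //; exact: es_bimod.
Qed.

Lemma species_quiver_contV : continuous_action (@actV _ _ _ (species_quiver iota S)).
Proof.
apply/continuous_actionP; [exact: actV1|exact: actVM|] => -[i f].
have [Y YP] := open_stabilizer (field_finite_etale (es_field i)) f.
by exists Y => g /YP gf; rewrite /= /sq_actV /= gf.
Qed.

Lemma species_quiver_contE : continuous_action (@actE _ _ _ (species_quiver iota S)).
Proof.
apply/continuous_actionP; [exact: actE1|exact: actEM|] => e.
rewrite -(edge_homK sepL e); move: (edge_hom e) => f.
have [Y YP] := open_stabilizer (@es_bimod _ S _ _) f.
by exists Y => g /YP gf; rewrite /= sq_actE_edge_of_hom gf.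
Qed.

Definition quiver_of_species : rational_quiver iota :=
  RationalQuiver species_quiver_finV species_quiver_finE
    species_quiver_contV species_quiver_contE.

End Objects.

Section Morphisms.
Variables (S T : etale_species K).

Section Map.
Variable u : species_hom S T.

Definition map_vertex (v : vertex (species_quiver iota T)) :
    vertex (species_quiver iota S) :=
  existT _ (sh_idx u (projT1 v)) (alg_comp (projT2 v) (sh_field u (projT1 v))).

Definition map_edge (e : edge (species_quiver iota T)) :
    edge (species_quiver iota S) :=
  edge_of_hom sepL (alg_comp (edge_hom e) (sh_bimod u (sq_i e) (sq_j e))).

Lemma map_edge_of_hom i j (f : alghom (sbimodK T i j) iota) :
  map_edge (edge_of_hom sepL f) = edge_of_hom sepL (alg_comp f (sh_bimod u i j)).
Proof. by rewrite /map_edge edge_of_homK. Qed.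

Definition quiver_hom_of_species :
  quiver_hom (species_quiver iota T) (species_quiver iota S).
Proof.
exists map_vertex map_edge.
- move=> e; rewrite /= src_edge_of_hom; congr existT; apply: alghom_eq => x /=.
  by rewrite sh_left.
- move=> e; rewrite /= tgt_edge_of_hom; congr existT; apply: alghom_eq => x /=.
  by rewrite sh_right.
- by move=> g [i f]; congr existT; apply: alghom_eq.
- move=> g e; rewrite /= sq_actE_edge_of_hom; congr edge_of_hom.
  by apply: alghom_eq.
Defined.

End Map.

(** The index map can be read off on vertices because every L_i embeds into L;
the algebra maps are determined by their composites with the homomorphisms to
L. *)
Lemma quiver_hom_of_species_faithful (u v : species_hom S T) :
  quiver_hom_of_species u = quiver_hom_of_species v -> u = v.
Proof.
move=> uv.
have Vuv w : map_vertex u w = map_vertex v w.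
  by have := congr1 (fun h => qhV h w) uv.
have Euv e : map_edge u e = map_edge v e.
  by have := congr1 (fun h => qhE h e) uv.
have huv : sh_idx u = sh_idx v.
  apply/funext => i; have [f] := embedding_exists iota (es_field (e := T) i).2 Lsc.2.
  by have := congr1 (@projT1 _ _) (Vuv (existT _ i f)).
clear uv; case: u v Vuv Euv huv => [h f g l r] [h' f' g' l' r'] Vuv Euv /= huv.
subst h'; apply: species_hom_eq => [i x|i j x].
  apply: (etale_hom_separated Lsc (field_finite_etale (es_field i))) => k.
  exact: (alghom_eq_app (existT_inj (Vuv (existT _ i k))) x).
apply: (etale_hom_separated Lsc (@es_bimod _ T i j)) => k.
have := Euv (edge_of_hom sepL k); rewrite !map_edge_of_hom => fg.
exact: (alghom_eq_app (edge_of_hom_inj fg) x).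
Qed.

(** The vertices over i form one orbit, so phi maps them to vertices over a
single index h(i), and then the edges over (i, j) to edges over (h(i), h(j)).
On each of these sets phi is an equivariant map between sets of homomorphisms to
L, which etale_hom_duality turns into an algebra map. Compatibility with the
bimodule structures is compatibility of phi with sources and targets, tested
against all homomorphisms to L. *)
Lemma quiver_hom_of_species_full
    (phi : quiver_hom (species_quiver iota T) (species_quiver iota S)) :
  exists u : species_hom S T, quiver_hom_of_species u = phi.
Proof.
have emb i : {f : alghom (sfieldK T i) iota | True}.
  apply: cid; have [f] := embedding_exists iota (es_field (e := T) i).2 Lsc.2.
  by exists f.
pose h i := projT1 (qhV phi (existT _ i (sval (emb i)))).
have hP i (f : alghom (sfieldK T i) iota) :
    exists f' : alghom (sfieldK S (h i)) iota,
    qhV phi (existT _ i f) = existT _ (h i) f'.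
  have [s ->] := gal_transitive Lsc (sval (emb i)) f.
  have -> : existT _ i (alg_comp s (sval (emb i))) =
    actV s (existT _ i (sval (emb i)) : vertex (species_quiver iota T)) by [].
  rewrite qh_actV /h; case: (qhV phi _) => i' f'; by exists (alg_comp s f').
have uF i : {g : alghom (sfieldK S (h i)) (sfieldK T i) |
    forall f, qhV phi (existT _ i f) = existT _ (h i) (alg_comp f g)}.
  apply: cid; have [c cP] := choice (hP i).
  have [s f|g gP] := etale_hom_duality Lsc (field_finite_etale (es_field i)) (c := c).
    apply: (@existT_inj _ (fun k => alghom (sfieldK S k) iota)); rewrite -cP.
    have -> : existT _ i (alg_comp s f) =
      actV s (existT _ i f : vertex (species_quiver iota T)) by [].
    by rewrite qh_actV cP.
  by exists g => f; rewrite cP gP.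
have hE i j (f : alghom (sbimodK T i j) iota) :
    exists f' : alghom (sbimodK S (h i) (h j)) iota,
    qhE phi (edge_of_hom sepL f) = edge_of_hom sepL f'.
  apply: edge_of_hom_exists.
    have := congr1 (@projT1 _ _) (qh_src phi (edge_of_hom sepL f)).
    by rewrite /= src_edge_of_hom (svalP (uF i)).
  have := congr1 (@projT1 _ _) (qh_tgt phi (edge_of_hom sepL f)).
  by rewrite /= tgt_edge_of_hom (svalP (uF j)).
have uB i j : {g : alghom (sbimodK S (h i) (h j)) (sbimodK T i j) |
    forall f, qhE phi (edge_of_hom sepL f) = edge_of_hom sepL (alg_comp f g)}.
  apply: cid; have [c cP] := choice (@hE i j).
  have [s f|g gP] := etale_hom_duality Lsc (@es_bimod _ T i j) (c := c).
    apply: edge_of_hom_inj; rewrite -cP -!sq_actE_edge_of_hom -cP.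
    exact: (qh_actE phi).
  by exists g => f; rewrite cP gP.
have left i j x : sval (uB i j) (sleft S _ _ x) = sleft T i j (sval (uF i) x).
  apply: (etale_hom_separated Lsc (@es_bimod _ T i j)) => f.
  have := qh_src phi (edge_of_hom sepL f).
  rewrite (svalP (uB i j)) /= !src_edge_of_hom (svalP (uF i)) => fg.
  exact: (alghom_eq_app (existT_inj fg) x).
have right i j x : sval (uB i j) (sright S _ _ x) = sright T i j (sval (uF j) x).
  apply: (etale_hom_separated Lsc (@es_bimod _ T i j)) => f.
  have := qh_tgt phi (edge_of_hom sepL f).
  rewrite (svalP (uB i j)) /= !tgt_edge_of_hom (svalP (uF j)) => fg.
  exact: (alghom_eq_app (existT_inj fg) x).
exists (SpeciesHom left right); apply: quiver_hom_eq.
  by apply/funext => -[i f]; rewrite /= (svalP (uF i)).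
by apply/funext => e; rewrite -(edge_homK sepL e) /= map_edge_of_hom (svalP (uB _ _)).
Qed.

End Morphisms.
End SpeciesToQuiver.

(** * Quasi-inverses of fully faithful functors *)

Section QuasiInverse.
Variables (C D : category) (G : contrafunctor D C).
Hypothesis Gfull : forall X Y (f : hom (G Y) (G X)), exists u : hom X Y, fhom G u = f.
Hypothesis Gfaithful : forall X Y (u v : hom X Y), fhom G u = fhom G v -> u = v.
Variables (F0 : C -> D) (b : forall X, hom X (G (F0 X))).
Hypothesis biso : forall X, is_iso (b X).

(** On morphisms, F is the transport of f along the isomorphisms b, lifted through
G. Functoriality and naturality hold after applying G, hence before. *)
Lemma quasi_inverse_of_fully_faithful :
  exists F : contrafunctor C D, (forall X, F X = F0 X) /\ quasi_inverse F G.
Proof.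
pose c X := sval (cid (biso X)).
have cb X : compc (c X) (b X) = idc X by exact: (svalP (cid (biso X))).1.
have bc X : compc (b X) (c X) = idc _ by exact: (svalP (cid (biso X))).2.
have lift X Y (f : hom X Y) :
    {u : hom (F0 Y) (F0 X) | fhom G u = compc (b Y) (compc f (c X))}.
  exact/cid/Gfull.
pose Fh X Y (f : hom X Y) := sval (lift X Y f).
have FhE X Y f : fhom G (Fh X Y f) = compc (b Y) (compc f (c X)).
  exact: (svalP (lift X Y f)).
have Fh1 X : Fh X X (idc X) = idc (F0 X).
  by apply: Gfaithful; rewrite FhE comp1c bc fhom1.
have FhM X Y Z (g : hom Y Z) (f : hom X Y) :
    Fh X Z (compc g f) = compc (Fh X Y f) (Fh Y Z g).
  apply: Gfaithful; rewrite fhomM !FhE.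
  rewrite -[RHS]compcA; congr (compc (b Z)); rewrite -!compcA; congr (compc g).
  by rewrite [RHS]compcA cb comp1c.
pose F := @Contrafunctor C D F0 Fh Fh1 FhM.
exists F; split=> //; split.
  exists b; split=> // X Y f.
  by rewrite /= FhE -!compcA cb compc1.
(* G is contravariant: the lift of the inverse of b at G S starts at S. *)
have inv S : {u : hom S (F0 (G S)) | fhom G u = c (G S)} by exact/cid/Gfull.
exists (fun S => sval (inv S)); split=> [S|S T f].
  have [v Gv] := Gfull (b (G S)); exists v.
  by split; apply: Gfaithful; rewrite fhomM (svalP (inv S)) Gv fhom1.
apply: Gfaithful; rewrite !fhomM (svalP (inv T)) (svalP (inv S)) /= FhE.
by rewrite compcA cb comp1c.
Qed.

End QuasiInverse.

Lemma quasi_inverse_restrict (C D : category) (P : C -> Prop) (Q : D -> Prop)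
    (F : contrafunctor C D) (G : contrafunctor D C)
    (FPQ : forall X, P X -> Q (F X)) (GQP : forall Y, Q Y -> P (G Y)) :
  quasi_inverse F G -> quasi_inverse (restrict_functor FPQ) (restrict_functor GQP).
Proof.
move=> [[a [aiso anat]] [b [biso bnat]]]; split.
  exists (fun X : full_subcategory P => a (sval X)).
  by split=> [X|X Y f]; [exact: aiso|exact: anat].
exists (fun Y : full_subcategory Q => b (sval Y)).
by split=> [X|X Y f]; [exact: biso|exact: bnat].
Qed.

(** * The species of a quiver and the unit *)

Section ProductIso.
Variable K : comPzRingType.

Lemma alg_iso_sym (A B : comPzRingType) (a : {rmorphism K -> A})
  (b : {rmorphism K -> B}) : alg_iso a b -> alg_iso b a.
Proof. by move=> [f /alghom_inverse[g [fK gK]]]; exists g, f. Qed.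

Lemma alg_iso_trans (A B C : comPzRingType) (a : {rmorphism K -> A})
  (b : {rmorphism K -> B}) (c : {rmorphism K -> C}) :
  alg_iso a b -> alg_iso b c -> alg_iso a c.
Proof. by move=> [f fb] [g gb]; exists (alg_comp g f); exact: bij_comp. Qed.

Variables (I : Type) (R : I -> comPzRingType) (b : forall i, {rmorphism K -> R i}).

Lemma prod_alg_iso (R' : I -> comPzRingType) (b' : forall i, {rmorphism K -> R' i}) :
  (forall i, alg_iso (b i) (b' i)) -> alg_iso (prod_rmorphism b) (prod_rmorphism b').
Proof.
move=> bb'; have isos i : {f : alghom (b i) (b' i) & {g : alghom (b' i) (b i) |
    cancel f g /\ cancel g f}}.
  have [f fb] := cid (bb' i); exists f; apply: cid.
  exact: alghom_inverse fb.
pose f := prod_rmorphism (fun i => algf (alg_comp (projT1 (isos i)) (alg_proj b i))).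
have fK k : f (prod_rmorphism b k) = prod_rmorphism b' k.
  by apply: functional_extensionality_dep => i; exact: (alghomK (projT1 (isos i))).
exists (AlgHom fK), (fun y i => sval (projT2 (isos i)) (y i)) => x;
  apply: functional_extensionality_dep => i /=.
- exact: (svalP (projT2 (isos i))).1.
- exact: (svalP (projT2 (isos i))).2.
Qed.

Lemma prod_alg_reindex (J : Type) (u : J -> I) :
    injective u -> (forall i, exists k, u k = i) ->
  alg_iso (prod_rmorphism b) (prod_rmorphism (fun k => b (u k))).
Proof.
move=> uinj usurj.
have v i : {k | u k = i} by exact: cid (usurj i).
pose f := prod_rmorphism (fun k => algf (alg_proj b (u k))).
have fK k : f (prod_rmorphism b k) = prod_rmorphism (fun k => b (u k)) k by [].
exists (AlgHom fK), (fun y i => eq_rect _ R (y (sval (v i))) _ (proj2_sig (v i))) => x;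
  apply: functional_extensionality_dep => i /=.
- by case: (v i) => k /= uk; subst i.
- rewrite /prod_fun /=; case: (v (u i)) => k /= uk; have ki := uinj _ _ uk; subst k.
  by rewrite (Prop_irrelevance uk erefl).
Qed.

End ProductIso.

Section OpenStabilizers.
Variables (K L : fieldType) (iota : {rmorphism K -> L}).
Hypothesis Lsc : separable_closure iota.
Variables (X : Type) (act : gal iota -> X -> X).
Hypothesis act1 : forall x, act 1%g x = x.
Hypothesis actM : forall g h x, act (g * h)%g x = act g (act h x).
Hypothesis act_cont : continuous_action act.

Variable x : X.
Let H : set (gal iota) := [set g | act g x = x].

Let H1 : H 1%g. Proof. exact: act1. Qed.
Let HM g h : H g -> H h -> H (g * h)%g.
Proof. by rewrite /H /= actM => gx ->. Qed.
Let HV g : H g -> H g^-1%g.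
Proof. by rewrite /H /= => gx; rewrite -{1}gx -actM mulVg. Qed.

Lemma stabilizer_finite_separable : finite_separable (fixedK H).
Proof.
have [Y YP] := (continuous_actionP act1 actM).1 act_cont x.
exact: (fixed_field_finite_separable Lsc (X := Y)).
Qed.

(** The embeddings of the fixed field of a stabilizer correspond to the points of
the orbit: g and h restrict to the same embedding exactly if h^-1 g fixes that
field pointwise, that is, lies in the stabilizer. *)
Lemma stabilizer_emb_eq (g h : gal iota) :
  alg_comp g (fixed_emb H) = alg_comp h (fixed_emb H) <-> act g x = act h x.
Proof.
split=> [gh|gh].
  have [Y YP] := (continuous_actionP act1 actM).1 act_cont x.
  suff : H (h^-1 * g)%g by rewrite /H /= => {2}<-; rewrite -actM mulgA mulgV mul1g.
  apply: (open_subgroup_closed Lsc H1 HM HV YP) => y yH.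
  have /= := alghom_eq_app gh (FixedField yH).
  by move=> ->; rewrite -galM mulVg.
apply: alghom_eq => y /=.
have /(fixed_predP _ _ (ff_valP y)) : H (h^-1 * g)%g.
  by rewrite /H /= actM gh -actM mulVg.
by move=> {2}<-; rewrite -[RHS]galM mulgA mulgV mul1g.
Qed.

End OpenStabilizers.

Section QuiverToSpecies.
Variables (K L : fieldType) (iota : {rmorphism K -> L}).
Hypothesis Lsc : separable_closure iota.
Variables (Q : rational_quiver iota) (r : representatives Q).

Let sepL : separable_extension iota := Lsc.1.

Definition orbV (v : vertex Q) : orbitsV Q := exist _ (orbitV v) (ex_intro _ v erefl).
Definition orbE (e : edge Q) : orbitsE Q := exist _ (orbitE e) (ex_intro _ e erefl).

Lemma orbV_eq (i : orbitsV Q) v : sval i v -> i = orbV v.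
Proof.
case: i => O [w Ow] /= vO; apply: eq_exist; rewrite {}Ow in vO *.
case: vO => g ->; apply/seteqP; split=> _ [h ->].
  by exists (h * g^-1)%g; rewrite -actVM -mulgA mulVg mulg1.
by exists (h * g)%g; rewrite actVM.
Qed.

Lemma orbE_eq (i : orbitsE Q) e : sval i e -> i = orbE e.
Proof.
case: i => O [w Ow] /= vO; apply: eq_exist; rewrite {}Ow in vO *.
case: vO => g ->; apply/seteqP; split=> _ [h ->].
  by exists (h * g^-1)%g; rewrite -actEM -mulgA mulVg mulg1.
by exists (h * g)%g; rewrite actEM.
Qed.

Lemma orbV_act g v : orbV (actV g v) = orbV v.
Proof. by apply/esym/orbV_eq; exists g. Qed.

Lemma orbE_act g e : orbE (actE g e) = orbE e.
Proof. by apply/esym/orbE_eq; exists g. Qed.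

Lemma orbV_rep i : orbV (repV r i) = i.
Proof. by apply/esym/orbV_eq/repV_in. Qed.

Lemma orbE_rep i : orbE (repE r i) = i.
Proof. by apply/esym/orbE_eq/repE_in. Qed.

Lemma repV_transitive v : exists g, v = actV g (repV r (orbV v)).
Proof.
have [g ->] := repV_in r (orbV v); exists g^-1%g.
by rewrite -actVM mulVg actV1.
Qed.

Lemma repE_transitive e : exists g, e = actE g (repE r (orbE e)).
Proof.
have [g ->] := repE_in r (orbE e); exists g^-1%g.
by rewrite -actEM mulVg actE1.
Qed.

Lemma orbitsV_finite : finite_set [set: orbitsV Q].
Proof.
apply: (finite_inj (f := repV r)); last exact: rq_finV.
by move=> i j ij; rewrite -(orbV_rep i) ij orbV_rep.
Qed.

Lemma edge_orbits_finite i j : finite_set [set: edge_orbits (Q := Q) i j].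
Proof.
apply: (finite_inj (f := fun eps => repE r (sval eps))); last exact: rq_finE.
move=> [e1 p1] [e2 p2] /= ij; apply: eq_exist.
by rewrite -(orbE_rep e1) ij orbE_rep.
Qed.

Lemma qs_fieldK_finite_separable i : finite_separable (qs_fieldK r i).
Proof.
exact: (stabilizer_finite_separable Lsc (@actV1 _ _ _ Q) (@actVM _ _ _ Q)
  (@rq_contV _ _ _ Q) (repV r i)).
Qed.

Lemma qs_bimodK_finite_etale i j : finite_etale (qs_bimodK r i j).
Proof.
have [n [u [uinj usurj]]] := finite_enum (edge_orbits_finite i j).
exists n, (fun k => fixed_field (stabE (repE r (sval (u k))))),
  (fun k => fixedK (stabE (repE r (sval (u k))))); split.
  move=> k.
  exact: (stabilizer_finite_separable Lsc (@actE1 _ _ _ Q) (@actEM _ _ _ Q)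
    (@rq_contE _ _ _ Q) (repE r (sval (u k)))).
exact: prod_alg_reindex.
Qed.

Definition species_of_quiver : etale_species K :=
  @EtaleSpecies K (quiver_species r) orbitsV_finite
    qs_fieldK_finite_separable qs_bimodK_finite_etale.

Local Notation S := (quiver_species r).

Definition vertex_hom (i : orbitsV Q) (g : gal iota) : alghom (sfieldK S i) iota :=
  alg_comp g (fixed_emb (stabV (repV r i))).

Definition edge_orbit_hom i j (eps : edge_orbits i j) (g : gal iota) :
    alghom (sbimodK S i j) iota :=
  alg_comp (alg_comp g (fixed_emb (stabE (repE r (sval eps)))))
    (alg_proj (fun eps : edge_orbits i j => fixedK (stabE (repE r (sval eps)))) eps).

Lemma vertex_hom_eq i (g h : gal iota) :
  vertex_hom i g = vertex_hom i h <-> actV g (repV r i) = actV h (repV r i).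
Proof.
exact: (stabilizer_emb_eq Lsc (@actV1 _ _ _ Q) (@actVM _ _ _ Q) (@rq_contV _ _ _ Q)
  (repV r i)).
Qed.

(** The vertex v = g v_i is sent to the embedding of L(v_i) induced by g; the
choice of g is immaterial by vertex_hom_eq. *)
Definition unit_vertex (v : vertex Q) : sq_vertex iota S :=
  existT _ (orbV v) (vertex_hom (orbV v) (sval (cid (repV_transitive v)))).

(** This form lets the orbit i and the element g be chosen freely, which spares
transports along equalities of orbits. *)
Lemma unit_vertexE i g v : v = actV g (repV r i) ->
  unit_vertex v = existT _ i (vertex_hom i g).
Proof.
move=> vg; have iv : i = orbV v by rewrite vg orbV_act orbV_rep.
subst i; congr existT; apply/vertex_hom_eq.
by rewrite -vg; case: cid => h /= <-.
Qed.

Lemma edge_orbit_subproof e :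
  sval (orbE e) `<=` edges_between (orbV (src e)) (orbV (tgt e)).
Proof.
move=> _ [g ->]; split; first by exists g; rewrite src_act.
by exists g; rewrite tgt_act.
Qed.

Definition edge_orbit e : edge_orbits (orbV (src e)) (orbV (tgt e)) :=
  exist _ (orbE e) (@edge_orbit_subproof e).

Definition unit_edge (e : edge Q) : sq_edge iota S :=
  edge_of_hom sepL (edge_orbit_hom (edge_orbit e) (sval (cid (repE_transitive e)))).

Lemma edge_orbit_hom_eq i j (eps : edge_orbits i j) (g h : gal iota) :
  edge_orbit_hom eps g = edge_orbit_hom eps h <->
  actE g (repE r (sval eps)) = actE h (repE r (sval eps)).
Proof.
have E := stabilizer_emb_eq Lsc (@actE1 _ _ _ Q) (@actEM _ _ _ Q) (@rq_contE _ _ _ Q)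
  (repE r (sval eps)) g h.
split=> [gh|/E gh]; last first.
  by apply: alghom_eq => x; exact: (alghom_eq_app gh).
apply/E/alghom_eq => y.
pose R (d : edge_orbits i j) := fixed_field (stabE (repE r (sval d))) : comPzRingType.
have := alghom_eq_app gh (prod_single (R := R) y).
by rewrite /= /prod_single; case: pselect => // p; rewrite (Prop_irrelevance p erefl).
Qed.

Lemma unit_edgeE i j (eps : edge_orbits i j) g e : e = actE g (repE r (sval eps)) ->
  unit_edge e = edge_of_hom sepL (edge_orbit_hom eps g).
Proof.
move=> eg.
have epse : sval eps = orbE e by rewrite eg orbE_act orbE_rep.
have [/orbV_eq ie /orbV_eq je] : edges_between i j e.
  by apply: (svalP eps); rewrite epse; exists 1%g; rewrite actE1.
subst i j; congr edge_of_hom.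
have {}epse : eps = edge_orbit e.
  by case: eps epse {eg} => o p /= epse; exact: eq_exist.
by subst eps; apply/edge_orbit_hom_eq; rewrite -eg; case: cid => h /= <-.
Qed.

Definition unit_hom : quiver_hom Q (species_quiver iota S).
Proof.
exists unit_vertex unit_edge.
- move=> e; rewrite /= src_edge_of_hom.
  case: cid => g /= eg.
  rewrite (@unit_vertexE (orbV (src e)) (g * rep_sigma r (orbE e))%g); last first.
    by rewrite actVM -(rep_src r (edge_orbit e)) -src_act -eg.
  by congr existT; apply: alghom_eq.
- move=> e; rewrite /= tgt_edge_of_hom.
  case: cid => g /= eg.
  rewrite (@unit_vertexE (orbV (tgt e)) (g * rep_tau r (orbE e))%g); last first.
    by rewrite actVM -(rep_tgt r (edge_orbit e)) -tgt_act -eg.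
  by congr existT; apply: alghom_eq.
- move=> g v; have [h vh] := repV_transitive v.
  rewrite (unit_vertexE vh) (@unit_vertexE (orbV v) (g * h)%g) ?actVM -?vh //.
  by congr existT; apply: alghom_eq.
- move=> g e; have [h eh] := repE_transitive e.
  have geh : actE g e = actE (g * h)%g (repE r (sval (edge_orbit e))).
    by rewrite actEM -eh.
  rewrite (unit_edgeE geh) (unit_edgeE (eps := edge_orbit e) eh).
  by rewrite /= sq_actE_edge_of_hom; congr edge_of_hom; apply: alghom_eq.
Defined.

End QuiverToSpecies.

(** * The anti-equivalence *)

Lemma quiver_hom_iso (K L : fieldType) (iota : {rmorphism K -> L})
    (Q R : quiver_category iota) (f : quiver_hom Q R) :
  bijective (qhV f) -> bijective (qhE f) -> is_iso (f : hom Q R).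
Proof.
move=> [gV fVK gVK] [gE fEK gEK].
have g_src e : src (gE e) = gV (src e).
  by apply: (can_inj fVK); rewrite gVK -qh_src gEK.
have g_tgt e : tgt (gE e) = gV (tgt e).
  by apply: (can_inj fVK); rewrite gVK -qh_tgt gEK.
have g_actV s v : gV (actV s v) = actV s (gV v).
  by apply: (can_inj fVK); rewrite gVK qh_actV gVK.
have g_actE s e : gE (actE s e) = actE s (gE e).
  by apply: (can_inj fEK); rewrite gEK qh_actE gEK.
exists (QuiverHom g_src g_tgt g_actV g_actE).
by split; apply: quiver_hom_eq; apply/funext => x /=; rewrite ?fVK ?gVK ?fEK ?gEK.
Qed.

Lemma inj_surj_bijective (X Y : Type) (f : X -> Y) :
  injective f -> (forall y, exists x, f x = y) -> bijective f.
Proof.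
move=> finj /choice[g gK]; exists g => //.
by move=> x; apply: finj; rewrite gK.
Qed.

Section Unit.
Variables (K L : fieldType) (iota : {rmorphism K -> L}).
Hypothesis Lsc : separable_closure iota.
Variables (Q : rational_quiver iota) (r : representatives Q).

(** Every embedding of L(v_i) into L is the restriction of an automorphism. *)
Lemma unit_vertex_bijective : bijective (unit_vertex r).
Proof.
apply: inj_surj_bijective => [v w vw|[i f]].
  have [g vg] := repV_transitive r v; have [h wh] := repV_transitive r w.
  have iw : orbV v = orbV w by exact: (congr1 (@projT1 _ _) vw).
  rewrite -iw in wh; move: vw; rewrite (unit_vertexE Lsc vg) (unit_vertexE Lsc wh).
  by move=> E; have := existT_inj E => /(vertex_hom_eq Lsc); rewrite -vg -wh.
have [g ->] := gal_transitive Lsc (fixed_emb (stabV (repV r i))) f.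
by exists (actV g (repV r i)); rewrite (unit_vertexE Lsc (erefl _)).
Qed.

(** A homomorphism from the product of the L(e_eps) to L factors through one of
them, which determines eps; its embeddings are the edges in eps. *)
Lemma unit_edge_bijective : bijective (unit_edge Lsc r).
Proof.
apply: inj_surj_bijective => [d e de|e].
  have [g dg] := repE_transitive r d; have [h eh] := repE_transitive r e.
  have srcE : orbV (src d) = orbV (src e) by exact: (congr1 (@sq_i _ _ _ _) de).
  have tgtE : orbV (tgt d) = orbV (tgt e) by exact: (congr1 (@sq_j _ _ _ _) de).
  have eps : {eps : edge_orbits (orbV (src d)) (orbV (tgt d)) | sval eps = orbE e}.
    by rewrite srcE tgtE; exists (edge_orbit e).
  case: eps => eps epsE; rewrite -epsE in eh.
  move: de; rewrite (unit_edgeE Lsc (eps := edge_orbit d) dg) (unit_edgeE Lsc eh).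
  move=> /edge_of_hom_inj fg.
  have ed : eps = edge_orbit d.
    apply: contrapT => neq.
    (* The idempotent of the orbit of d is sent to 1 by one side only. *)
    pose x : qs_bimod r (orbV (src d)) (orbV (tgt d)) :=
      prod_single (i := edge_orbit d) 1.
    have := alghom_eq_app fg x; rewrite /= /x prod_singleE rmorph1.
    rewrite /prod_single; case: pselect => [/esym//|_].
    by rewrite rmorph0 => /eqP; rewrite oner_eq0.
  subst eps; move/(edge_orbit_hom_eq Lsc): fg; rewrite -eh => <-.
  exact: dg.
rewrite -(edge_homK Lsc.1 e).
move: (sq_i e) (sq_j e) (edge_hom e) => i j f.
have [eps [k kP]] := prod_hom_factor (edge_orbits_finite r i j) f.
have [g kg] := gal_transitive Lsc (fixed_emb (stabE (repE r (sval eps)))) k.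
exists (actE g (repE r (sval eps))); rewrite (unit_edgeE Lsc (erefl _)).
by congr edge_of_hom; apply: alghom_eq => x; rewrite /= kP kg.
Qed.

End Unit.

Section Functors.
Variables (K L : fieldType) (iota : {rmorphism K -> L}).
Hypothesis Lsc : separable_closure iota.

Lemma quiver_of_species_id (S : species_category K) :
  quiver_hom_of_species Lsc (idc S) =
  idc (quiver_of_species Lsc S : quiver_category iota).
Proof.
apply: quiver_hom_eq; apply/funext.
  by move=> [i f]; congr existT; apply: alghom_eq.
by move=> e; rewrite -[RHS](edge_homK Lsc.1); congr edge_of_hom; apply: alghom_eq.
Qed.

Lemma quiver_of_species_comp (S T U : species_category K) (g : hom T U) (f : hom S T) :
  quiver_hom_of_species Lsc (compc g f) =
  @compc (quiver_category iota) (quiver_of_species Lsc U) (quiver_of_species Lsc T)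
    (quiver_of_species Lsc S) (quiver_hom_of_species Lsc f)
    (quiver_hom_of_species Lsc g).
Proof.
apply: quiver_hom_eq; apply/funext.
  by move=> [i h]; congr existT; apply: alghom_eq.
move=> e; rewrite -(edge_homK Lsc.1 e) /= !map_edge_of_hom.
by congr edge_of_hom; apply: alghom_eq => x /=; rewrite kernel_funE.
Qed.

Definition quiver_functor : contrafunctor (species_category K) (quiver_category iota) :=
  @Contrafunctor (species_category K) (quiver_category iota)
    (quiver_of_species Lsc) (fun S T u => quiver_hom_of_species Lsc u)
    quiver_of_species_id quiver_of_species_comp.

(** The fixed field of the whole Galois group is K. *)
Lemma split_quiver_species (Q : rational_quiver iota) (r : representatives Q) :
  split_quiver Q -> split_species (quiver_species r).
Proof.
move=> [splitV splitE].
have fixed_iso (H : set (gal iota)) : (forall g, H g) -> alg_iso (idrm K) (fixedK H).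
  move=> HT; exists (@AlgHom _ _ _ (idrm K) (fixedK H) (fixedK H) (fun=> erefl)).
  apply: inj_surj_bijective => [|x]; first exact: fmorph_inj.
  have [|y xy] := @fixed_by_pointwise_stabilizer _ _ _ Lsc _ (idrm K)
      (@AlgHom _ _ _ (idrm K) iota iota (fun=> erefl)) (val x).
    by move=> s _; apply: (fixed_predP _ _ (ff_valP x)); exact: HT.
  by exists y; apply: val_inj.
move=> i j; split; first by apply: fixed_iso => g; exact: splitV.
have [n [u [uinj usurj]]] := finite_enum (edge_orbits_finite r i j).
exists n; apply: alg_iso_trans (prod_alg_reindex _ uinj usurj) _.
apply: prod_alg_iso => k; apply/alg_iso_sym/fixed_iso => g; exact: splitE.
Qed.

(** A homomorphism to L from K, or from a product of copies of K, takes values in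
K, and the Galois group fixes those. *)
Lemma split_species_quiver (S : species K) :
  split_species S -> split_quiver (species_quiver iota S).
Proof.
move=> splitS; split=> g.
  move=> [i f]; congr existT; apply: alghom_eq => x /=.
  have [[h [h' _ hK]] _] := splitS i i.
  rewrite -[x]hK; move: (h' x) => k.
  by rewrite -[k]/(idrm K k) (alghomK h) alghomK alghomK.
move=> e; rewrite -(edge_homK Lsc.1 e); move: (edge_hom e) => f.
rewrite /= sq_actE_edge_of_hom; congr edge_of_hom; apply: alghom_eq => x /=.
have [_ [n [h /alghom_inverse[h' [hK h'K]]]]] := splitS (sq_i e) (sq_j e).
have [|k [f' f'P]] := prod_hom_factor _ (alg_comp f h').
  exact: finite_finset.
rewrite -[x]hK; have /= -> := f'P (h x); move: (h x k) => y.
by rewrite -[y]/(idrm K y) !alghomK.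
Qed.

End Functors.

Theorem theorem2p17 (K L : fieldType) (iota : {rmorphism K -> L})
    (L_sepclosure : separable_closure iota)
    (r : forall Q : rational_quiver iota, representatives Q) :
  exists (F : contrafunctor (quiver_category iota) (species_category K))
         (G : contrafunctor (species_category K) (quiver_category iota)),
    (forall Q : rational_quiver iota,
       es_species (fobj F Q) = quiver_species (r Q)) /\
    (forall S : etale_species K,
       rq_quiver (fobj G S) = species_quiver iota S) /\
    quasi_inverse F G /\
    exists (splitF : forall Q : quiver_category iota,
              is_split_quiver Q -> is_split_species (fobj F Q))
           (splitG : forall S : species_category K,
              is_split_species S -> is_split_quiver (fobj G S)),
      quasi_inverse (restrict_functor splitF) (restrict_functor splitG).
Proof.
pose G := quiver_functor L_sepclosure.
pose F0 (Q : quiver_category iota) : species_category K :=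
  species_of_quiver L_sepclosure (r Q).
have [|||F [FE FG]] := @quasi_inverse_of_fully_faithful _ _ G _ _ F0
    (fun Q => unit_hom L_sepclosure (r Q)).
- exact: quiver_hom_of_species_full.
- exact: quiver_hom_of_species_faithful.
- move=> Q; apply: quiver_hom_iso; first exact: unit_vertex_bijective.
  exact: unit_edge_bijective.
have FS Q : es_species (fobj F Q) = quiver_species (r Q) by rewrite FE.
exists F, G; split=> //; split=> //; split=> //.
have splitF (Q : quiver_category iota) :
    is_split_quiver Q -> is_split_species (fobj F Q).
  by rewrite /is_split_species FS; exact: split_quiver_species.
have splitG (S : species_category K) :
    is_split_species S -> is_split_quiver (fobj G S).
  exact: split_species_quiver.
by exists splitF, splitG; exact: quasi_inverse_restrict.
Qed.
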